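(* Let $p,q$ be nonnegative integers, let $\kappa_1,\dots,\kappa_p,\mu_1,\dots,\mu_q$ be complex numbers none of which is in $\{0,-1,-2,\dots\}$, let $\alpha,\beta\in\mathbb{C}$ with $\Re(\alpha)>0$, let $\lambda_2,\lambda_3\in\mathbb{C}$ with $\Re(\lambda_3)>\Re(\lambda_2)>0$, let $\rho\in\mathbb{C}$ with $\Re(\rho)>0$, let $z\in\mathbb{C}$, and let $n\in\mathbb{N}$. Then the $n$-th order derivative of the M-confluent hypergeometric function is $$\frac{d^{n}}{dz^{n}}\left\lbrace {}^{M}\Phi_{p,q}^{(\alpha,\beta)}(\lambda_{2};\lambda_{3};z;\rho)\right\rbrace =\frac{(\lambda_2)_{n}}{(\lambda_3)_{n}}\;{}^{M}\Phi_{p,q}^{(\alpha,\beta)}(\lambda_{2}+n;\lambda_{3}+n;z;\rho).$$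
   Context: $(\lambda)_m=\Gamma(\lambda+m)/\Gamma(\lambda)$, $(\lambda)_0=1$ is the Pochhammer symbol and $B(x,y)=\int_0^1 t^{x-1}(1-t)^{y-1}dt$ is the classical beta function. The generalized M-series is $${}_{p}^{\alpha}M^{\beta}_{q}(\kappa_{1},\ldots,\kappa_{p};\mu_{1},\ldots,\mu_{q};z)=\sum_{m=0}^{\infty}\frac{(\kappa_{1})_{m}\cdots(\kappa_p)_{m}}{(\mu_1)_{m}\cdots(\mu_q)_{m}}\frac{z^{m}}{\Gamma(\alpha m+\beta)}.$$ With parameters $\kappa_1,\dots,\kappa_p;\mu_1,\dots,\mu_q$ suppressed from the notation, the modified beta (M-beta) and modified confluent hypergeometric (M-confluent hypergeometric) functions are $${}^{M}B_{p,q}^{(\alpha,\beta)}(x,y;\rho)=\int_{0}^{1}t^{x-1}(1-t)^{y-1}\,{}_{p}^{\alpha}M^{\beta}_{q}\left(\kappa_{1},\ldots,\kappa_{p};\mu_{1},\ldots,\mu_{q};\frac{-\rho}{t(1-t)}\right) dt,$$ $${}^{M}\Phi_{p,q}^{(\alpha,\beta)}(\lambda_{2};\lambda_{3};z;\rho)=\sum_{n=0}^{\infty}\frac{{}^{M}B_{p,q}^{(\alpha,\beta)}(\lambda_{2}+n,\lambda_{3}-\lambda_{2};\rho)}{B(\lambda_{2},\lambda_{3}-\lambda_{2})}\frac{z^{n}}{n!}.$$ These functions are defined for those parameters and arguments for which the series and integrals converge. *)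

(* Defs.v *)
From Stdlib Require Import Reals List Factorial.
From Coquelicot Require Import Coquelicot.

(* [C] is the type of complex numbers, shadowing the binomial coefficient of Reals. *)

Local Open Scope C_scope.

Definition nonpos_int (z : C) : Prop := exists k : nat, z = - RtoC (INR k).

Definition Cexp (z : C) : C :=
  RtoC (exp (Re z)) * (cos (Im z), sin (Im z)).

(* Principal value of t^s, meaningful for t > 0 only. *)
Definition rcpow (t : R) (s : C) : C := Cexp (s * RtoC (ln t)).

Definition Cprod (l : list C) : C := fold_right Cmult (RtoC 1) l.

(* The sum when [ex_series a] holds over C; unspecified otherwise. *)
Definition CSeries (a : nat -> C) : C :=
  (Series (fun n => Re (a n)), Series (fun n => Im (a n))).

Definition ex_CSeries (a : nat -> C) : Prop :=
  @ex_series C_AbsRing C_NormedModule a.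

(* Integrals over (0, b) are improper Riemann integrals at both ends, so that
   conditionally convergent ones are allowed. *)
Definition CInt01 (f : R -> C) : C :=
  @RInt_gen C_R_CompleteNormedModule f (at_right 0) (at_left 1).

Definition ex_CInt01 (f : R -> C) : Prop :=
  @ex_RInt_gen C_R_CompleteNormedModule f (at_right 0) (at_left 1).

(* Euler's integral, convergent for Re z > 0. *)
Definition EulerGamma (z : C) : C :=
  @RInt_gen C_R_CompleteNormedModule
    (fun t : R => rcpow t (z - RtoC 1) * RtoC (exp (- t)))
    (at_right 0) (Rbar_locally p_infty).

(* z (z + 1) ... (z + N - 1) *)
Fixpoint rising (z : C) (N : nat) : C :=
  match N with
  | O => RtoC 1
  | S k => rising z k * (z + RtoC (INR k))
  end.

(* The least N with Re z + N > 0; in particular 0 when Re z > 0. *)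
Definition gamma_shift (z : C) : nat := Z.to_nat (up (- Re z)).

(* Analytic continuation by Gamma(z + N) = z (z + 1) ... (z + N - 1) Gamma(z);
   meaningful away from the poles 0, -1, -2, ... *)
Definition CGamma (z : C) : C :=
  EulerGamma (z + RtoC (INR (gamma_shift z))) / rising z (gamma_shift z).

(* The entire function 1 / Gamma, which vanishes at the poles of Gamma. *)
Definition RGamma (z : C) : C :=
  rising z (gamma_shift z) / EulerGamma (z + RtoC (INR (gamma_shift z))).

Definition pochhammer (l : C) (m : nat) : C :=
  match m with
  | O => RtoC 1
  | S _ => CGamma (l + RtoC (INR m)) / CGamma l
  end.

Definition CBeta (x y : C) : C :=
  CInt01 (fun t => rcpow t (x - RtoC 1) * rcpow (1 - t) (y - RtoC 1)).

(* The numbers p and q of parameters are the lengths of [kappa] and [mu]. The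
   value alpha m + beta may be a pole of Gamma for finitely many m, whence
   [RGamma]. *)
Definition MSeries_term (kappa mu : list C) (alpha beta z : C) (m : nat) : C :=
  Cprod (map (fun k => pochhammer k m) kappa)
    / Cprod (map (fun k => pochhammer k m) mu)
    * (@pow_n C_Ring z m * RGamma (alpha * RtoC (INR m) + beta)).

Definition MSeries (kappa mu : list C) (alpha beta z : C) : C :=
  CSeries (MSeries_term kappa mu alpha beta z).

Definition MSeries_defined (kappa mu : list C) (alpha beta z : C) : Prop :=
  ex_CSeries (MSeries_term kappa mu alpha beta z).

Definition MBeta_arg (rho : C) (t : R) : C := - rho / RtoC (t * (1 - t)).

Definition MBeta_integrand (kappa mu : list C) (alpha beta x y rho : C)
    (t : R) : C :=
  rcpow t (x - RtoC 1) * rcpow (1 - t) (y - RtoC 1)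
    * MSeries kappa mu alpha beta (MBeta_arg rho t).

Definition MBeta (kappa mu : list C) (alpha beta x y rho : C) : C :=
  CInt01 (MBeta_integrand kappa mu alpha beta x y rho).

Definition MBeta_defined (kappa mu : list C) (alpha beta x y rho : C) : Prop :=
  (forall t : R, (0 < t < 1)%R ->
     MSeries_defined kappa mu alpha beta (MBeta_arg rho t))
  /\ ex_CInt01 (MBeta_integrand kappa mu alpha beta x y rho).

Definition MPhi_term (kappa mu : list C) (alpha beta l2 l3 z rho : C)
    (n : nat) : C :=
  MBeta kappa mu alpha beta (l2 + RtoC (INR n)) (l3 - l2) rho
    / CBeta l2 (l3 - l2)
    * (@pow_n C_Ring z n / RtoC (INR (fact n))).

Definition MPhi (kappa mu : list C) (alpha beta l2 l3 z rho : C) : C :=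
  CSeries (MPhi_term kappa mu alpha beta l2 l3 z rho).

Definition MPhi_defined (kappa mu : list C) (alpha beta l2 l3 z rho : C)
    : Prop :=
  (forall n : nat,
     MBeta_defined kappa mu alpha beta (l2 + RtoC (INR n)) (l3 - l2) rho)
  /\ ex_CSeries (MPhi_term kappa mu alpha beta l2 l3 z rho).

(* [l] is the n-th complex derivative of [f] at [z]; for n > 0 this includes
   the existence of the lower order derivatives near [z]. *)
Fixpoint is_Cderive_n (f : C -> C) (n : nat) (z l : C) : Prop :=
  match n with
  | O => f z = l
  | S k => exists g : C -> C,
      @locally C_UniformSpace z (fun w => is_Cderive_n f k w (g w))
      /\ @is_derive C_AbsRing C_NormedModule g z l
  end.

(* Main.v *)
(* Put [c_m = MB(l2 + m, l3 - l2) / B(l2, l3 - l2)], so that [Phi(z)] is the sum of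
   [c_m z^m / m!]. The numerators are the moments of [t^m] against one fixed function
   whose improper integral over (0, 1) converges, possibly only conditionally; since
   [t^m] is monotone with values in [0, 1], these moments are bounded. Hence the series
   is entire, and its n-th derivative is the sum of [c_(n + m) z^m / m!]. The coefficients
   of [Phi(l2 + n; l3 + n; z)] have the same numerators, and the denominators are related
   by [(l2)_n B(l2, l3 - l2) = (l3)_n B(l2 + n, l3 - l2)], which follows from integration
   by parts. Identifying [(l)_n = Gamma(l + n) / Gamma(l)] with [l (l + 1) ... (l + n - 1)]
   requires [Gamma] to have no zeros in the right half-plane. *)

Require Import Defs.
From Stdlib Require Import Reals List Lra Lia Factorial.
From Coquelicot Require Import Coquelicot.
Local Open Scope C_scope.

(** * Improper integrals *)

(** Conditional convergence provides no integrable majorant, so neither dominated convergence nor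
    differentiation under the integral sign applies to the M-beta integrals. All that is extracted
    from them is one bound valid for every moment; it compares the series with a multiple of the
    exponential series and makes the remainder of the termwise linearization quadratic in the
    increment. For the Gamma and beta integrals, integrability rests on majorants whose closed
    antiderivatives have finite limits, so that one formula serves both ends. Zeros of Gamma are
    excluded without a product or reflection formula: the functional equation pushes a zero
    horizontally to the right, into a region where comparing Gamma at the real points x - 1, x and x
    + 1 shows that the integral is nonzero. Non-vanishing of the beta function is bypassed by the
    convention [/ 0 = 0]; only rising factorials are cancelled. *)

Lemma is_RInt_gen_Re (f : R -> C) (Fa Fb : (R -> Prop) -> Prop) (l : C) :
  @is_RInt_gen C_R_NormedModule f Fa Fb l ->
  is_RInt_gen (fun t => Re (f t)) Fa Fb (Re l).
Proof.
  intros H P [e He].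
  assert (Hl : @locally C_R_NormedModule l (fun z => P (Re z))).
  { exists e. intros z [Hz _]. now apply He. }
  destruct (H _ Hl) as [Q S HQ HS HP].
  exists Q S; auto.
  intros x y Hx Hy. destruct (HP x y Hx Hy) as [z [Hz Pz]].
  exists (Re z). split; auto.
  now apply (@is_RInt_fct_extend_fst R_NormedModule R_NormedModule f x y z).
Qed.

Lemma is_RInt_gen_Im (f : R -> C) (Fa Fb : (R -> Prop) -> Prop) (l : C) :
  @is_RInt_gen C_R_NormedModule f Fa Fb l ->
  is_RInt_gen (fun t => Im (f t)) Fa Fb (Im l).
Proof.
  intros H P [e He].
  assert (Hl : @locally C_R_NormedModule l (fun z => P (Im z))).
  { exists e. intros z [_ Hz]. now apply He. }
  destruct (H _ Hl) as [Q S HQ HS HP].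
  exists Q S; auto.
  intros x y Hx Hy. destruct (HP x y Hx Hy) as [z [Hz Pz]].
  exists (Im z). split; auto.
  now apply (@is_RInt_fct_extend_snd R_NormedModule R_NormedModule f x y z).
Qed.

Lemma is_RInt_gen_C (f : R -> C) (Fa Fb : (R -> Prop) -> Prop) (l : C) :
  Filter Fa -> Filter Fb ->
  is_RInt_gen (fun t => Re (f t)) Fa Fb (Re l) ->
  is_RInt_gen (fun t => Im (f t)) Fa Fb (Im l) ->
  @is_RInt_gen C_R_NormedModule f Fa Fb l.
Proof.
  intros FFa FFb Hr Hi P [e He].
  destruct (Hr (ball (Re l) e)) as [Q S HQ HS HP]; [now exists e|].
  destruct (Hi (ball (Im l) e)) as [Q' S' HQ' HS' HP']; [now exists e|].
  exists (fun x => Q x /\ Q' x) (fun x => S x /\ S' x).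
  1, 2: now apply filter_and.
  intros x y [Hx Hx'] [Hy Hy'].
  destruct (HP x y Hx Hy) as [u [Hu Pu]].
  destruct (HP' x y Hx' Hy') as [v [Hv Pv]].
  exists (u, v). split.
  - now apply (@is_RInt_fct_extend_pair R_NormedModule R_NormedModule).
  - apply He. now split.
Qed.

(* The filters [Fa] and [Fb] converge to the two ends of the interval [D]. *)
Record interval_ends (D : R -> Prop) (Fa Fb : (R -> Prop) -> Prop) : Prop := {
  ends_left : Fa D;
  ends_right : Fb D;
  ends_convex : forall x y t, D x -> D y -> (x <= t <= y)%R -> D t;
  ends_below : forall x, D x -> Fa (fun a => (a < x)%R);
  ends_above : forall x, D x -> Fb (fun b => (x < b)%R)
}.

Section ImproperIntegral.

Context (D : R -> Prop) (Fa Fb : (R -> Prop) -> Prop).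
Context {FFa : ProperFilter Fa} {FFb : ProperFilter Fb}.
Hypothesis HD : interval_ends D Fa Fb.

Local Open Scope R_scope.

(** Any point [c] of [D] separates the two ends: eventually [a < c < b], which settles the
    orientation of the bounds. *)
Lemma ends_eventually (P : R -> R -> Prop) :
  (forall a b, D a -> D b -> a < b -> P a b) ->
  filter_prod Fa Fb (fun ab => P (fst ab) (snd ab)).
Proof.
  intros H.
  destruct (filter_ex _ (ends_left _ _ _ HD)) as [c Dc].
  exists (fun a => D a /\ a < c) (fun b => D b /\ c < b).
  - apply filter_and; [apply HD|now apply (ends_below _ _ _ HD)].
  - apply filter_and; [apply HD|now apply (ends_above _ _ _ HD)].
  - intros a b [Ha Hac] [Hb Hcb]. apply H; auto. simpl in *; lra.
Qed.

Lemma ends_eventually_in (P : R -> Prop) :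
  (forall t, D t -> P t) ->
  filter_prod Fa Fb (fun ab => forall t, fst ab <= t <= snd ab -> P t).
Proof.
  intros H.
  apply (ends_eventually (fun a b => forall t, a <= t <= b -> P t)).
  intros a b Ha Hb Hab t Ht. apply H.
  now apply (ends_convex _ _ _ HD a b).
Qed.

Lemma is_RInt_gen_ext_in (f g : R -> R) (l : R) :
  (forall t, D t -> f t = g t) ->
  is_RInt_gen f Fa Fb l -> is_RInt_gen g Fa Fb l.
Proof.
  intros H. apply is_RInt_gen_ext; try apply FFa; try apply FFb.
  apply (ends_eventually (fun a b => forall t, Rmin a b < t < Rmax a b -> f t = g t)).
  intros a b Ha Hb Hab t. rewrite Rmin_left, Rmax_right by lra.
  intros Ht. apply H. apply (ends_convex _ _ _ HD a b); auto; lra.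
Qed.

Lemma is_RInt_gen_antiderivative (F f : R -> R) (la lb : R) :
  (forall t, D t -> is_derive F t (f t)) ->
  (forall t, D t -> continuous f t) ->
  filterlim F Fa (locally la) -> filterlim F Fb (locally lb) ->
  is_RInt_gen f Fa Fb (lb - la).
Proof.
  intros HF Hf Ha Hb P HP.
  assert (Hlim : filterlim (fun ab => F (snd ab) - F (fst ab))
                   (filter_prod Fa Fb) (locally (lb - la))).
  { apply (filterlim_comp_2 (fun ab : R * R => F (snd ab)) (fun ab => - F (fst ab))
      Rplus (G := locally lb) (H := locally (- la))).
    - apply (filterlim_comp _ _ _ _ _ _ _ _ filterlim_snd Hb).
    - apply (filterlim_comp _ _ _ (fun ab : R * R => F (fst ab)) Ropp _ (locally la)).
      + apply (filterlim_comp _ _ _ _ _ _ _ _ filterlim_fst Ha).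
      + apply (filterlim_opp (V := R_NormedModule) la).
    - apply (filterlim_plus (V := R_NormedModule)). }
  assert (Hint : filter_prod Fa Fb (fun ab =>
    is_RInt f (fst ab) (snd ab) (F (snd ab) - F (fst ab)))).
  { apply (ends_eventually (fun a b => is_RInt f a b (F b - F a))).
    intros a b Da Db Hab.
    apply (is_RInt_derive F f a b); rewrite Rmin_left, Rmax_right by lra;
      intros t Ht; [apply HF | apply Hf]; now apply (ends_convex _ _ _ HD a b). }
  specialize (Hlim P HP). unfold filtermap in Hlim. unfold filtermapi.
  generalize (filter_and _ _ Hint Hlim). apply filter_imp. intros ab [H1 H2].
  exists (F (snd ab) - F (fst ab)). now split.
Qed.

(** Cauchy criterion: moving a bound changes the integral of [f] by at most an increment of [P], and
    these increments tend to 0 at both ends. An integrability test thus reduces to exhibiting an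
    antiderivative [P] of a majorant. *)
Lemma ex_RInt_gen_dominated (f P p : R -> R) (la lb : R) :
  (forall t, D t -> continuous f t) ->
  (forall t, D t -> is_derive P t (p t)) ->
  (forall t, D t -> continuous p t) ->
  (forall t, D t -> Rabs (f t) <= p t) ->
  filterlim P Fa (locally la) -> filterlim P Fb (locally lb) ->
  ex_RInt_gen f Fa Fb.
Proof.
  intros Hf HP Hp Hfp Ha Hb.
  assert (Hex : forall a b, D a -> D b -> ex_RInt f a b).
  { intros a b Da Db. apply (ex_RInt_continuous (V := R_CompleteNormedModule)).
    intros t Ht. apply Hf. destruct (Rle_dec a b).
    - rewrite Rmin_left, Rmax_right in Ht by lra. now apply (ends_convex _ _ _ HD a b).
    - rewrite Rmin_right, Rmax_left in Ht by lra. now apply (ends_convex _ _ _ HD b a). }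
  assert (Hle : forall a b, D a -> D b -> a <= b -> Rabs (RInt f a b) <= P b - P a).
  { intros a b Da Db Hab.
    apply (norm_RInt_le f p a b); auto.
    - intros t Ht. apply Hfp. now apply (ends_convex _ _ _ HD a b).
    - apply (RInt_correct (V := R_CompleteNormedModule)). now apply Hex.
    - apply (is_RInt_derive P p a b); rewrite Rmin_left, Rmax_right by lra;
        intros t Ht; [apply HP | apply Hp]; now apply (ends_convex _ _ _ HD a b). }
  (* The unordered version: in the Cauchy criterion [a'] may lie on either side of [a]. *)
  assert (Hle' : forall a b, D a -> D b -> Rabs (RInt f a b) <= Rabs (P b - P a)).
  { intros a b Da Db. destruct (Rle_dec a b).
    - eapply Rle_trans; [now apply Hle|]. apply Rle_abs.
    - rewrite <- (opp_RInt_swap (V := R_CompleteNormedModule)) by now apply Hex.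
      unfold opp; simpl. rewrite Rabs_Ropp, Rabs_minus_sym.
      eapply Rle_trans; [apply Hle; auto; lra|]. apply Rle_abs. }
  assert (Hc : exists l : R, filterlim (fun ab => RInt f (fst ab) (snd ab))
                 (filter_prod Fa Fb) (locally l)).
  { apply (filterlim_locally_cauchy (U := R_CompleteSpace)).
    intros eps. pose proof (cond_pos eps) as Heps.
    (* Two increments of [P], each compared with a limit at both of its points, make four errors. *)
    assert (He : 0 < eps / 4) by lra.
    pose proof (Ha _ (locally_ball la (mkposreal _ He))) as Ha'.
    pose proof (Hb _ (locally_ball lb (mkposreal _ He))) as Hb'.
    unfold filtermap, ball in Ha', Hb'; simpl in Ha', Hb'.
    unfold AbsRing_ball, abs, minus, plus, opp in Ha', Hb'; simpl in Ha', Hb'.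
    exists (fun ab => (D (fst ab) /\ Rabs (P (fst ab) + - la) < eps / 4)
              /\ (D (snd ab) /\ Rabs (P (snd ab) + - lb) < eps / 4)).
    split.
    - exists (fun a => D a /\ Rabs (P a + - la) < eps / 4)
             (fun b => D b /\ Rabs (P b + - lb) < eps / 4).
      + apply filter_and; [apply HD|auto].
      + apply filter_and; [apply HD|auto].
      + now intros x y.
    - intros [a b] [a' b']; simpl. intros [[Da Pa] [Db Pb]] [[Da' Pa'] [Db' Pb']].
      unfold ball; simpl. unfold AbsRing_ball, abs, minus, plus, opp; simpl.
      rewrite <- (RInt_Chasles (V := R_CompleteNormedModule) f a' a b')
        by now apply Hex.
      rewrite <- (RInt_Chasles (V := R_CompleteNormedModule) f a b b')
        by now apply Hex.
      unfold plus; simpl.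
      pose proof (Hle' a' a Da' Da). pose proof (Hle' b b' Db Db').
      revert H H0 Pa Pb Pa' Pb'. unfold Rabs.
      repeat (destruct Rcase_abs); lra. }
  destruct Hc as [l Hl]. exists l. intros Q HQ.
  specialize (Hl Q HQ). unfold filtermap in Hl. unfold filtermapi.
  generalize (filter_and _ _ (ends_eventually (fun a b => ex_RInt f a b)
    (fun a b Da Db _ => Hex a b Da Db)) Hl).
  apply filter_imp. intros ab [H1 H2]. exists (RInt f (fst ab) (snd ab)). split; [|apply H2].
  now apply (RInt_correct (V := R_CompleteNormedModule)).
Qed.

(** The norm inequality for improper integrals, applied to the zero function dominated by [g - f],
    yields [0 <= lg - lf]. *)
Lemma is_RInt_gen_le (f g : R -> R) (lf lg : R) :
  (forall t, D t -> f t <= g t) ->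
  is_RInt_gen f Fa Fb lf -> is_RInt_gen g Fa Fb lg -> lf <= lg.
Proof.
  intros Hfg Hf Hg.
  assert (H : is_RInt_gen (fun t => minus (g t) (f t)) Fa Fb (minus lg lf)).
  { apply (is_RInt_gen_minus (V := R_NormedModule)); auto. }
  assert (H0 : is_RInt_gen (fun _ => 0) Fa Fb (0 - 0)).
  { apply (is_RInt_gen_antiderivative (fun _ => 0)).
    - intros; apply (is_derive_const (V := R_NormedModule)).
    - intros; apply continuous_const.
    - apply filterlim_const.
    - apply filterlim_const. }
  rewrite Rminus_0_r in H0.
  enough (norm 0 <= minus lg lf) as Hn.
  { revert Hn. unfold norm, minus, plus, opp; simpl. unfold abs; simpl.
    rewrite Rabs_R0. lra. }
  refine (RInt_gen_norm (V := R_CompleteNormedModule) _ _ _ _ _ _ H0 H).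
  - apply (ends_eventually (fun a b => a <= b)). intros; lra.
  - apply ends_eventually_in. intros t Dt. specialize (Hfg t Dt).
    unfold norm, minus, plus, opp; simpl. unfold abs; simpl. rewrite Rabs_R0. lra.
Qed.

(** Strictness comes from a fixed segment from [c] to [d]: every integral over a larger segment is
    at least the positive integral over this one, so the limit cannot be [<= 0]. *)
Lemma is_RInt_gen_gt_0 (f : R -> R) (l : R) :
  (forall t, D t -> continuous f t) -> (forall t, D t -> 0 < f t) ->
  is_RInt_gen f Fa Fb l -> 0 < l.
Proof.
  intros Hc Hpos Hf.
  destruct (filter_ex _ (ends_left _ _ _ HD)) as [c Dc].
  destruct (filter_ex _ (filter_and _ _ (ends_right _ _ _ HD)
    (ends_above _ _ _ HD c Dc))) as [d [Dd Hcd]].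
  assert (Hex : forall a b, D a -> D b -> a <= b -> ex_RInt f a b).
  { intros a b Da Db Hab. apply (ex_RInt_continuous (V := R_CompleteNormedModule)).
    intros t Ht. rewrite Rmin_left, Rmax_right in Ht by lra.
    apply Hc. now apply (ends_convex _ _ _ HD a b). }
  assert (H0 : 0 < RInt f c d).
  { apply RInt_gt_0; auto; intros t Ht; [apply Hpos | apply Hc];
      apply (ends_convex _ _ _ HD c d); auto; lra. }
  assert (Hge : forall a b, D a -> D b -> a <= b -> 0 <= RInt f a b).
  { intros a b Da Db Hab. apply RInt_ge_0; auto. intros t Ht.
    apply Rlt_le, Hpos. apply (ends_convex _ _ _ HD a b); auto; lra. }
  destruct (Rlt_le_dec 0 l) as [|Hl]; auto. exfalso.
  assert (He : 0 < RInt f c d / 2) by lra.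
  pose proof (Hf _ (locally_ball l (mkposreal _ He))) as Hev.
  unfold filtermapi in Hev.
  assert (Hbig : filter_prod Fa Fb (fun ab => (D (fst ab) /\ fst ab < c) /\ (D (snd ab) /\ d < snd ab))).
  { exists (fun a => D a /\ a < c) (fun b => D b /\ d < b).
    - apply filter_and; [apply HD|now apply (ends_below _ _ _ HD)].
    - apply filter_and; [apply HD|now apply (ends_above _ _ _ HD)].
    - now intros. }
  destruct (filter_ex _ (filter_and _ _ Hev Hbig)) as [[a b] [[y [Hy Hby]] [[Da Hac] [Db Hdb]]]].
  simpl in *. apply (is_RInt_unique (V := R_CompleteNormedModule)) in Hy. subst y.
  rewrite <- (RInt_Chasles (V := R_CompleteNormedModule) f a c b) in Hby
    by (apply Hex; auto; lra).
  rewrite <- (RInt_Chasles (V := R_CompleteNormedModule) f c d b) in Hby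
    by (apply Hex; auto; lra).
  unfold ball in Hby; simpl in Hby.
  unfold AbsRing_ball, abs, minus, plus, opp in Hby; simpl in Hby.
  assert (0 <= RInt f a c) by (apply Hge; auto; lra).
  assert (0 <= RInt f d b) by (apply Hge; auto; lra).
  apply Rabs_lt_between in Hby. lra.
Qed.

End ImproperIntegral.

(** * Real and imaginary parts of complex powers and products *)

Lemma Re_rcpow (t : R) (s : C) :
  Re (rcpow t s) = (exp (Re s * ln t) * cos (Im s * ln t))%R.
Proof.
  unfold rcpow, Cexp. destruct s as [x y]. cbn [Re Im fst snd Cmult RtoC].
  rewrite !Rmult_0_r, Rminus_0_r, Rplus_0_l, Rmult_0_l, Rminus_0_r. reflexivity.
Qed.

Lemma Im_rcpow (t : R) (s : C) :
  Im (rcpow t s) = (exp (Re s * ln t) * sin (Im s * ln t))%R.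
Proof.
  unfold rcpow, Cexp. destruct s as [x y]. cbn [Re Im fst snd Cmult RtoC].
  rewrite !Rmult_0_r, Rminus_0_r, Rplus_0_l, Rmult_0_l, Rplus_0_r. reflexivity.
Qed.

Lemma Re_Cmult (a b : C) : Re (a * b) = (Re a * Re b - Im a * Im b)%R.
Proof. reflexivity. Qed.

Lemma Im_Cmult (a b : C) : Im (a * b) = (Re a * Im b + Im a * Re b)%R.
Proof. reflexivity. Qed.

Lemma Re_mult_RtoC (a : C) (r : R) : Re (a * RtoC r) = (Re a * r)%R.
Proof. unfold Re; simpl. ring. Qed.

Lemma Im_mult_RtoC (a : C) (r : R) : Im (a * RtoC r) = (Im a * r)%R.
Proof. unfold Im; simpl. ring. Qed.

Lemma Re_plus_RtoC (a : C) (r : R) : Re (a + RtoC r) = (Re a + r)%R.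
Proof. reflexivity. Qed.

Lemma Im_plus_RtoC (a : C) (r : R) : Im (a + RtoC r) = Im a.
Proof. unfold Im; simpl. ring. Qed.

Lemma Re_minus_RtoC (a : C) (r : R) : Re (a - RtoC r) = (Re a - r)%R.
Proof. reflexivity. Qed.

Lemma Im_minus_RtoC (a : C) (r : R) : Im (a - RtoC r) = Im a.
Proof. unfold Im; simpl. ring. Qed.

Lemma C_eq (a b : C) : Re a = Re b -> Im a = Im b -> a = b.
Proof. destruct a, b; unfold Re, Im; simpl; congruence. Qed.

Local Open Scope R_scope.

Local Open Scope C_scope.

(** [C_R_NormedModule] carries real scalars only, so a complex factor has to be distributed over
    real and imaginary parts. *)
Lemma is_RInt_gen_Cmult (Fa Fb : (R -> Prop) -> Prop) (c : C)
    (f : R -> C) (l : C) :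
  Filter Fa -> Filter Fb ->
  @is_RInt_gen C_R_NormedModule f Fa Fb l ->
  @is_RInt_gen C_R_NormedModule (fun t => c * f t) Fa Fb (c * l).
Proof.
  intros FFa FFb H.
  pose proof (is_RInt_gen_Re _ _ _ _ H) as Hr.
  pose proof (is_RInt_gen_Im _ _ _ _ H) as Hi.
  apply is_RInt_gen_C; auto.
  - exact (is_RInt_gen_minus (V := R_NormedModule) _ _ _ _
      (is_RInt_gen_scal (V := R_NormedModule) _ (Re c) _ Hr)
      (is_RInt_gen_scal (V := R_NormedModule) _ (Im c) _ Hi)).
  - exact (is_RInt_gen_plus (V := R_NormedModule) _ _ _ _
      (is_RInt_gen_scal (V := R_NormedModule) _ (Re c) _ Hi)
      (is_RInt_gen_scal (V := R_NormedModule) _ (Im c) _ Hr)).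
Qed.

(* Integration by parts: [u + i v] is an antiderivative of [c f - d g] vanishing
   at both ends. *)
Lemma is_RInt_gen_Cmult_eq (D : R -> Prop) (Fa Fb : (R -> Prop) -> Prop)
    {FFa : ProperFilter Fa} {FFb : ProperFilter Fb} (HD : interval_ends D Fa Fb)
    (f g : R -> C) (u v : R -> R) (c d lf lg : C) :
  @is_RInt_gen C_R_NormedModule f Fa Fb lf ->
  @is_RInt_gen C_R_NormedModule g Fa Fb lg ->
  (forall t, D t -> is_derive u t (Re (c * f t - d * g t))) ->
  (forall t, D t -> is_derive v t (Im (c * f t - d * g t))) ->
  (forall t, D t -> continuous (fun t => Re (f t)) t) ->
  (forall t, D t -> continuous (fun t => Im (f t)) t) ->
  (forall t, D t -> continuous (fun t => Re (g t)) t) ->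
  (forall t, D t -> continuous (fun t => Im (g t)) t) ->
  filterlim u Fa (locally 0%R) -> filterlim u Fb (locally 0%R) ->
  filterlim v Fa (locally 0%R) -> filterlim v Fb (locally 0%R) ->
  c * lf = d * lg.
Proof.
  intros Hf Hg Hu Hv Cfr Cfi Cgr Cgi Lua Lub Lva Lvb.
  assert (H0 : @is_RInt_gen C_R_NormedModule (fun t => c * f t - d * g t) Fa Fb (RtoC 0)).
  { apply is_RInt_gen_C; try apply filter_filter.
    - change (Re (RtoC 0)) with 0%R. rewrite <- (Rminus_diag 0).
      apply (is_RInt_gen_antiderivative D _ _ HD u); auto.
      intros t Dt.
      apply (continuous_minus (V := R_NormedModule) (fun t => Re (c * f t)) (fun t => Re (d * g t)));
      apply (continuous_minus (V := R_NormedModule));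
      apply (continuous_scal_r (V := R_NormedModule)); auto.
    - change (Im (RtoC 0)) with 0%R. rewrite <- (Rminus_diag 0).
      apply (is_RInt_gen_antiderivative D _ _ HD v); auto.
      intros t Dt.
      apply (continuous_minus (V := R_NormedModule) (fun t => Im (c * f t)) (fun t => Im (d * g t)));
      apply (continuous_plus (V := R_NormedModule));
      apply (continuous_scal_r (V := R_NormedModule)); auto. }
  assert (H1 : @is_RInt_gen C_R_NormedModule (fun t => c * f t - d * g t) Fa Fb (c * lf - d * lg)).
  { apply (is_RInt_gen_minus (V := C_R_NormedModule)); apply is_RInt_gen_Cmult;
      auto; apply filter_filter. }
  apply (is_RInt_gen_unique (V := C_R_CompleteNormedModule)) in H0.
  apply (is_RInt_gen_unique (V := C_R_CompleteNormedModule)) in H1.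
  assert (H : c * lf - d * lg = RtoC 0) by (rewrite <- H0; now symmetry).
  replace (c * lf) with (c * lf - d * lg + d * lg) by ring. rewrite H. ring.
Qed.

Local Open Scope R_scope.

Lemma interval_ends_pos :
  interval_ends (fun t => 0 < t) (at_right 0) (Rbar_locally p_infty).
Proof.
  split.
  - exists (mkposreal 1 Rlt_0_1). now intros.
  - now exists 0.
  - intros; lra.
  - intros x Hx. exists (mkposreal x Hx). intros y Hy _.
    revert Hy. unfold ball; simpl. unfold AbsRing_ball, abs, minus, plus, opp; simpl.
    intros Hy. apply Rabs_lt_between in Hy. lra.
  - intros x Hx. now exists x.
Qed.

Lemma interval_ends_01 :
  interval_ends (fun t => 0 < t < 1) (at_right 0) (at_left 1).
Proof.
  assert (Hb : forall x y e : R, ball x e y -> - e < y - x < e).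
  { intros x y e. unfold ball; simpl. unfold AbsRing_ball, abs, minus, plus, opp; simpl.
    intros H. apply Rabs_lt_between in H. lra. }
  split.
  - exists (mkposreal 1 Rlt_0_1). intros y Hy Hy'. apply Hb in Hy. simpl in Hy. lra.
  - exists (mkposreal 1 Rlt_0_1). intros y Hy Hy'. apply Hb in Hy. simpl in Hy. lra.
  - intros; lra.
  - intros x [Hx _]. exists (mkposreal x Hx). intros y Hy _. apply Hb in Hy. simpl in Hy. lra.
  - intros x [_ Hx]. assert (H : 0 < 1 - x) by lra.
    exists (mkposreal _ H). intros y Hy _. apply Hb in Hy. simpl in Hy. lra.
Qed.

Lemma filterlim_squeeze_0 {T} (F : (T -> Prop) -> Prop) {FF : Filter F} (f g : T -> R) :
  F (fun x => Rabs (f x) <= g x) ->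
  filterlim g F (locally 0) -> filterlim f F (locally 0).
Proof.
  intros Hfg Hg. apply (filterlim_locally (U := R_UniformSpace)). intros eps.
  pose proof (proj1 (filterlim_locally (U := R_UniformSpace) g 0) Hg eps) as H.
  generalize (filter_and _ _ Hfg H). apply filter_imp.
  intros x [H1 H2]. revert H2. unfold ball; simpl.
  unfold AbsRing_ball, abs, minus, plus, opp; simpl.
  rewrite Ropp_0, !Rplus_0_r. intros H2. pose proof (Rle_abs (g x)). lra.
Qed.

(** * The gamma function *)

Lemma filterlim_at_right_pow_ln (x : R) :
  0 < x -> filterlim (fun t => exp (x * ln t)) (at_right 0) (locally 0).
Proof.
  intros Hx.
  apply (filterlim_comp _ _ _ (fun t => x * ln t) exp _ (Rbar_locally m_infty)).
  - apply (filterlim_comp _ _ _ ln (fun y => x * y) _ (Rbar_locally m_infty)).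
    + apply is_lim_ln_0.
    + intros P [M HM]. exists (M / x). intros y Hy. apply HM.
      apply (Rmult_lt_compat_l x) in Hy; auto.
      replace (x * (M / x)) with M in Hy by (field; lra). exact Hy.
  - apply is_lim_exp_m.
Qed.

Lemma filterlim_p_infty_exp_neg (c : R) :
  0 < c -> filterlim (fun t => exp (- (c * t))) (Rbar_locally p_infty) (locally 0).
Proof.
  intros Hx.
  apply (filterlim_comp _ _ _ (fun t => - (c * t)) exp _ (Rbar_locally m_infty)).
  - intros P [M HM]. exists (- M / c). intros y Hy. apply HM.
    apply (Rmult_lt_compat_l c) in Hy; auto.
    replace (c * (- M / c)) with (- M) in Hy by (field; lra). lra.
  - apply is_lim_exp_m.
Qed.

(** The tangent of the concave [ln] at [c], from [1 + u <= exp u] at [u = ln (t / c)]. It lets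
    [exp (- t)] absorb powers of [t]. *)
Lemma ln_le_affine (c t : R) : 0 < c -> 0 < t -> ln t <= ln c + t / c - 1.
Proof.
  intros Hc Ht.
  assert (H : 0 < t / c) by now apply Rdiv_lt_0_compat.
  pose proof (exp_ineq1_le (ln (t / c))) as H1. rewrite exp_ln in H1 by auto.
  unfold Rdiv in H1 at 1. rewrite ln_mult, ln_Rinv in H1; auto.
  2: now apply Rinv_0_lt_compat. lra.
Qed.

Lemma exp_le_exp (a b : R) : a <= b -> exp a <= exp b.
Proof. intros [H | ->]; [left; now apply exp_increasing | lra]. Qed.

Lemma exp_pow_ln_S (a t : R) : 0 < t -> exp ((a - 1) * ln t) * t = exp (a * ln t).
Proof.
  intros Ht. rewrite <- (exp_ln t) at 2 by auto. rewrite <- exp_plus. f_equal. ring.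
Qed.

(** The majorant is M t^(x - 1) / (1 + t^x)^2, the derivative of (M / x) t^x / (1 + t^x). It behaves
    like t^(x - 1) at 0 and like t^(- x - 1) at infinity, hence is integrable at both ends. *)
Lemma gamma_dominated (x : R) (f : R -> R) :
  0 < x -> (forall t, 0 < t -> continuous f t) ->
  (forall t, 0 < t -> Rabs (f t) <= exp ((x - 1) * ln t) * exp (- t)) ->
  ex_RInt_gen f (at_right 0) (Rbar_locally p_infty).
Proof.
  intros Hx Hc Hf.
  (* With u = t^x, [M] bounds exp(- t) (1 + u)^2 <= 2 exp(- t) + 2 exp(- t) u^2. The tangent of [ln]
     at 2x gives exp(- t) t^(2x) <= (2x)^(2x). *)
  set (M := 2 + 2 * exp (2 * x * ln (2 * x))).
  assert (HM : 0 < M) by (unfold M; pose proof (exp_pos (2 * x * ln (2 * x))); lra).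
  apply (ex_RInt_gen_dominated (fun t => 0 < t) _ _ interval_ends_pos f
    (fun t => M / x * (1 - / (1 + exp (x * ln t))))
    (fun t => M * exp ((x - 1) * ln t) / (1 + exp (x * ln t)) ^ 2) (M / x * (1 - / (1 + 0)))
    (M / x * (1 - 0))); auto.
  - intros t Ht. pose proof (exp_pos (x * ln t)). auto_derive.
    + repeat split; lra.
    + rewrite <- (exp_pow_ln_S x t) in H |- * by auto. field. repeat split; lra.
  - intros t Ht. pose proof (exp_pos (x * ln t)).
    apply (ex_derive_continuous (K := R_AbsRing) (V := R_NormedModule)).
    auto_derive. repeat split; auto. nra.
  - intros t Ht. eapply Rle_trans; [now apply Hf|].
    assert (Hu := exp_pos (x * ln t)). set (u := exp (x * ln t)) in *.
    assert (Hp := exp_pos ((x - 1) * ln t)).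
    assert (Hb : exp (- t) * (1 + u) ^ 2 <= M).
    { assert (H1 : exp (- t) <= 1).
      { rewrite <- exp_0. apply exp_le_exp. lra. }
      assert (H2 : exp (- t) * u ^ 2 <= exp (2 * x * ln (2 * x))).
      { unfold u. replace (exp (x * ln t) ^ 2) with (exp (x * ln t) * exp (x * ln t)) by ring.
        rewrite <- !exp_plus. apply exp_le_exp.
        pose proof (ln_le_affine (2 * x) t ltac:(lra) Ht) as H2.
        apply (Rmult_le_compat_l (2 * x)) in H2; [|lra].
        replace (2 * x * (ln (2 * x) + t / (2 * x) - 1))
          with (2 * x * ln (2 * x) + t - 2 * x) in H2 by (field; lra). lra. }
      pose proof (exp_pos (- t)). unfold M.
      assert (exp (- t) * (1 + u) ^ 2 <= 2 * exp (- t) + 2 * (exp (- t) * u ^ 2)).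
      { assert (0 <= exp (- t) * (1 - u) ^ 2) by (apply Rmult_le_pos; [lra|apply pow2_ge_0]).
        nra. }
      lra. }
    assert (H1 : 0 < (1 + u) ^ 2) by nra.
    apply (Rmult_le_reg_r ((1 + u) ^ 2)); auto.
    replace (M * exp ((x - 1) * ln t) / (1 + u) ^ 2 * (1 + u) ^ 2)
      with (exp ((x - 1) * ln t) * M) by (field; lra).
    rewrite Rmult_assoc. apply Rmult_le_compat_l; lra.
  - apply (filterlim_comp _ _ _ (fun t => exp (x * ln t))
      (fun u => M / x * (1 - / (1 + u))) _ (locally 0)).
    + now apply filterlim_at_right_pow_ln.
    + apply (ex_derive_continuous (K := R_AbsRing) (V := R_NormedModule)
        (fun u => M / x * (1 - / (1 + u))) 0). auto_derive. lra.
  - apply (filterlim_comp _ _ _ (fun t => / (1 + exp (x * ln t)))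
      (fun u => M / x * (1 - u)) _ (locally 0)).
    + apply (filterlim_squeeze_0 _ _ (fun t => exp (x * - ln t))).
      * exists 0. intros t Ht. pose proof (exp_pos (x * ln t)).
        rewrite Rabs_pos_eq by (left; apply Rinv_0_lt_compat; lra).
        replace (x * - ln t) with (- (x * ln t)) by ring. rewrite exp_Ropp.
        apply Rinv_le_contravar; lra.
      * apply (filterlim_comp _ _ _ (fun t => x * - ln t) exp _ (Rbar_locally m_infty)).
        -- apply (filterlim_comp _ _ _ ln (fun y => x * - y) _ (Rbar_locally p_infty)).
           ++ apply is_lim_ln_p.
           ++ intros P [N HN]. exists (- N / x). intros y Hy. apply HN.
              apply (Rmult_lt_compat_l x) in Hy; auto.
              replace (x * (- N / x)) with (- N) in Hy by (field; lra). lra.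
        -- apply is_lim_exp_m.
    + apply (ex_derive_continuous (K := R_AbsRing) (V := R_NormedModule)
        (fun u => M / x * (1 - u)) 0). auto_derive. auto.
Qed.

Lemma gamma_boundary (x : R) (f : R -> R) :
  0 < x -> (forall t, 0 < t -> Rabs (f t) <= exp (x * ln t) * exp (- t)) ->
  filterlim f (at_right 0) (locally 0) /\
  filterlim f (Rbar_locally p_infty) (locally 0).
Proof.
  intros Hx Hf. split.
  - apply (filterlim_squeeze_0 _ _ (fun t => exp (x * ln t))).
    + exists (mkposreal 1 Rlt_0_1). intros t _ Ht. eapply Rle_trans; [now apply Hf|].
      rewrite <- (Rmult_1_r (exp (x * ln t))) at 2.
      apply Rmult_le_compat_l; [left; apply exp_pos|].
      rewrite <- exp_0. apply exp_le_exp. lra.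
    + now apply filterlim_at_right_pow_ln.
  (* Half of the exponential decay absorbs the power: the tangent of [ln] at 2x gives t^x exp(- t)
     <= (2x)^x exp(- t / 2). *)
  - apply (filterlim_squeeze_0 _ _ (fun t => exp (x * ln (2 * x)) * exp (- (/ 2 * t)))).
    + exists 0. intros t Ht. eapply Rle_trans; [now apply Hf|].
      rewrite <- !exp_plus. apply exp_le_exp.
      pose proof (ln_le_affine (2 * x) t ltac:(lra) Ht) as H2.
      apply (Rmult_le_compat_l x) in H2; [|lra].
      replace (x * (ln (2 * x) + t / (2 * x) - 1))
        with (x * ln (2 * x) + / 2 * t - x) in H2 by (field; lra). lra.
    + apply (filterlim_comp _ _ _ (fun t => exp (- (/ 2 * t)))
        (fun u => exp (x * ln (2 * x)) * u) _ (locally 0)).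
      * apply filterlim_p_infty_exp_neg. lra.
      * replace 0 with (exp (x * ln (2 * x)) * 0) at 2 by ring.
        apply (filterlim_scal_r (K := R_AbsRing) (V := R_NormedModule)).
Qed.

Lemma Rabs_mult_le_1 (a b : R) : 0 <= a -> Rabs b <= 1 -> Rabs (a * b) <= a.
Proof.
  intros Ha Hb. rewrite Rabs_mult, (Rabs_pos_eq a) by auto. nra.
Qed.

Lemma Rabs_cos_le_1 (a : R) : Rabs (cos a) <= 1.
Proof. apply Rabs_le, COS_bound. Qed.

Lemma Rabs_sin_le_1 (a : R) : Rabs (sin a) <= 1.
Proof. apply Rabs_le, SIN_bound. Qed.

Local Open Scope C_scope.

Definition gamma_integrand (s : C) (t : R) : C :=
  rcpow t (s - RtoC 1) * RtoC (exp (- t)).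

Lemma Re_gamma_integrand (s : C) (t : R) :
  Re (gamma_integrand s t)
  = (exp ((Re s - 1) * ln t) * exp (- t) * cos (Im s * ln t))%R.
Proof.
  unfold gamma_integrand. rewrite Re_mult_RtoC, Re_rcpow, Re_minus_RtoC, Im_minus_RtoC. ring.
Qed.

Lemma Im_gamma_integrand (s : C) (t : R) :
  Im (gamma_integrand s t)
  = (exp ((Re s - 1) * ln t) * exp (- t) * sin (Im s * ln t))%R.
Proof.
  unfold gamma_integrand. rewrite Im_mult_RtoC, Im_rcpow, Re_minus_RtoC, Im_minus_RtoC. ring.
Qed.

Lemma continuous_Re_gamma_integrand (s : C) (t : R) :
  (0 < t)%R -> continuous (fun t => Re (gamma_integrand s t)) t.
Proof.
  intros Ht.
  apply (continuous_ext _ _ _ (fun t => eq_sym (Re_gamma_integrand s t))).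
  apply (ex_derive_continuous (K := R_AbsRing) (V := R_NormedModule)).
  auto_derive. auto.
Qed.

Lemma continuous_Im_gamma_integrand (s : C) (t : R) :
  (0 < t)%R -> continuous (fun t => Im (gamma_integrand s t)) t.
Proof.
  intros Ht.
  apply (continuous_ext _ _ _ (fun t => eq_sym (Im_gamma_integrand s t))).
  apply (ex_derive_continuous (K := R_AbsRing) (V := R_NormedModule)).
  auto_derive. auto.
Qed.

Lemma is_RInt_gen_EulerGamma (s : C) :
  (0 < Re s)%R ->
  @is_RInt_gen C_R_NormedModule (gamma_integrand s)
    (at_right 0) (Rbar_locally p_infty) (EulerGamma s).
Proof.
  intros Hs.
  apply (RInt_gen_correct (V := C_R_CompleteNormedModule)).
  assert (Hr : ex_RInt_gen (fun t => Re (gamma_integrand s t))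
                 (at_right 0) (Rbar_locally p_infty)).
  { apply (gamma_dominated (Re s)); auto; intros t Ht.
    - now apply continuous_Re_gamma_integrand.
    - rewrite Re_gamma_integrand, <- exp_plus.
      apply Rabs_mult_le_1; [left; apply exp_pos|apply Rabs_cos_le_1]. }
  assert (Hi : ex_RInt_gen (fun t => Im (gamma_integrand s t))
                 (at_right 0) (Rbar_locally p_infty)).
  { apply (gamma_dominated (Re s)); auto; intros t Ht.
    - now apply continuous_Im_gamma_integrand.
    - rewrite Im_gamma_integrand, <- exp_plus.
      apply Rabs_mult_le_1; [left; apply exp_pos|apply Rabs_sin_le_1]. }
  destruct Hr as [u Hu], Hi as [v Hv]. exists (u, v).
  apply is_RInt_gen_C; auto; apply filter_filter.
Qed.

(* Integrate the derivative of [t^s exp (- t)], which vanishes at both ends. *)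
Lemma EulerGamma_succ (s : C) :
  (0 < Re s)%R -> EulerGamma (s + RtoC 1) = s * EulerGamma s.
Proof.
  intros Hs.
  assert (Hs1 : (0 < Re (s + RtoC 1))%R) by (rewrite Re_plus_RtoC; lra).
  destruct (gamma_boundary (Re s)
    (fun t => exp (Re s * ln t) * exp (- t) * cos (Im s * ln t))%R) as [Lc0 Lc1]; auto.
  { intros t Ht. rewrite <- exp_plus.
    apply Rabs_mult_le_1; [left; apply exp_pos|apply Rabs_cos_le_1]. }
  destruct (gamma_boundary (Re s)
    (fun t => exp (Re s * ln t) * exp (- t) * sin (Im s * ln t))%R) as [Ls0 Ls1]; auto.
  { intros t Ht. rewrite <- exp_plus.
    apply Rabs_mult_le_1; [left; apply exp_pos|apply Rabs_sin_le_1]. }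
  rewrite <- (Cmult_1_l (EulerGamma (s + RtoC 1))). symmetry.
  apply (is_RInt_gen_Cmult_eq (fun t => 0 < t)%R _ _ interval_ends_pos
    (gamma_integrand s) (gamma_integrand (s + RtoC 1))
    (fun t => exp (Re s * ln t) * exp (- t) * cos (Im s * ln t))%R
    (fun t => exp (Re s * ln t) * exp (- t) * sin (Im s * ln t))%R).
  1, 2: now apply is_RInt_gen_EulerGamma.
  3, 5: apply continuous_Re_gamma_integrand.
  3, 4: apply continuous_Im_gamma_integrand.
  3, 4, 5, 6: assumption.
  all: intros t Ht.
  - unfold Cminus. rewrite Cmult_1_l. change (Re (s * gamma_integrand s t + - gamma_integrand (s + RtoC 1) t))
      with (Re s * Re (gamma_integrand s t) - Im s * Im (gamma_integrand s t)
            - Re (gamma_integrand (s + RtoC 1) t))%R.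
    rewrite !Re_gamma_integrand, Im_gamma_integrand, Re_plus_RtoC, Im_plus_RtoC.
    replace (Re s + 1 - 1)%R with (Re s) by ring.
    auto_derive; auto. rewrite <- (exp_pow_ln_S (Re s) t) by auto. field. lra.
  - rewrite Cmult_1_l. change (Im (s * gamma_integrand s t - gamma_integrand (s + RtoC 1) t))
      with (Re s * Im (gamma_integrand s t) + Im s * Re (gamma_integrand s t)
            - Im (gamma_integrand (s + RtoC 1) t))%R.
    rewrite !Im_gamma_integrand, Re_gamma_integrand, Re_plus_RtoC, Im_plus_RtoC.
    replace (Re s + 1 - 1)%R with (Re s) by ring.
    auto_derive; auto. rewrite <- (exp_pow_ln_S (Re s) t) by auto. field. lra.
Qed.

Lemma EulerGamma_rising (s : C) (n : nat) :
  (0 < Re s)%R -> EulerGamma (s + RtoC (INR n)) = rising s n * EulerGamma s.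
Proof.
  intros Hs. induction n as [|n IH].
  - simpl. rewrite Cplus_0_r, Cmult_1_l. reflexivity.
  - rewrite S_INR, RtoC_plus, Cplus_assoc, EulerGamma_succ, IH.
    + simpl. ring.
    + rewrite Re_plus_RtoC. pose proof (pos_INR n). lra.
Qed.

(** * Non-vanishing of Gamma in the right half-plane *)

Lemma one_minus_cos_le (a : R) : (1 - cos a <= a ^ 2 / 2)%R.
Proof.
  (* By [1 - cos a = 2 sin^2 (a / 2)] it suffices to compare [sin] with its argument; once [|a / 2|]
     exceeds 1, the bound [sin^2 <= 1] is enough. *)
  replace a with (2 * (a / 2))%R at 1 by field. rewrite cos_2a_sin.
  assert (H : (sin (a / 2) ^ 2 <= (a / 2) ^ 2)%R).
  { destruct (Rtotal_order (a / 2) 0) as [H | [H | H]].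
    - pose proof (sin_lt_x (- (a / 2)) ltac:(lra)). rewrite sin_neg in H0.
      destruct (Rle_dec (- (a / 2)) 1).
      + assert (0 <= sin (- (a / 2)))%R.
        { apply sin_ge_0; [lra|]. pose proof PI2_1. pose proof PI_RGT_0. lra. }
        rewrite sin_neg in H1. nra.
      + pose proof (SIN_bound (a / 2)). nra.
    - rewrite H, sin_0. lra.
    - pose proof (sin_lt_x (a / 2) H).
      destruct (Rle_dec (a / 2) 1).
      + assert (0 <= sin (a / 2))%R.
        { apply sin_ge_0; [lra|]. pose proof PI2_1. pose proof PI_RGT_0. lra. }
        nra.
      + pose proof (SIN_bound (a / 2)). nra. }
  nra.
Qed.

(** The parenthesis is the square of [exp (v / 2) - exp (- (v / 2))], that is of 2 sinh(v / 2),
    which is at least [|v / 2|] in absolute value. The factor 4 comes from this halving. *)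
Lemma sqr_le_cosh (v : R) : (v ^ 2 <= 4 * (exp v + exp (- v) - 2))%R.
Proof.
  assert (H : forall w, (0 <= w -> w <= exp w - exp (- w))%R).
  { intros w Hw. pose proof (exp_ineq1_le w).
    assert (exp (- w) <= / (1 + w))%R by (rewrite exp_Ropp; apply Rinv_le_contravar; lra).
    assert (/ (1 + w) <= 1)%R by (rewrite <- Rinv_1 at 2; apply Rinv_le_contravar; lra). lra. }
  assert (E : (exp v + exp (- v) - 2 = (exp (v / 2) - exp (- (v / 2))) ^ 2)%R).
  { replace v with (v / 2 + v / 2)%R at 1 2 by field.
    rewrite Ropp_plus_distr, !exp_plus.
    assert (exp (v / 2) * exp (- (v / 2)) = 1)%R.
    { rewrite <- exp_plus, Rplus_opp_r. apply exp_0. }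
    nra. }
  rewrite E. destruct (Rle_dec 0 v).
  - pose proof (H (v / 2)%R ltac:(lra)). nra.
  - pose proof (H (- (v / 2))%R ltac:(lra)). rewrite Ropp_involutive in H0. nra.
Qed.

Local Open Scope R_scope.

Lemma gamma_real (x : R) :
  0 < x ->
  is_RInt_gen (fun t => exp ((x - 1) * ln t) * exp (- t)) (at_right 0) (Rbar_locally p_infty)
    (Re (EulerGamma (RtoC x))).
Proof.
  intros Hx.
  apply (is_RInt_gen_ext_in (fun t => 0 < t) _ _ interval_ends_pos
    (fun t => Re (gamma_integrand (RtoC x) t))).
  - intros t _. rewrite Re_gamma_integrand. change (Im (RtoC x)) with 0.
    change (Re (RtoC x)) with x. rewrite Rmult_0_l, cos_0. ring.
  - apply is_RInt_gen_Re. now apply is_RInt_gen_EulerGamma.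
Qed.

Lemma Re_EulerGamma_succ (x : R) :
  0 < x -> Re (EulerGamma (RtoC (x + 1))) = x * Re (EulerGamma (RtoC x)).
Proof.
  intros Hx. rewrite RtoC_plus, EulerGamma_succ by auto. rewrite Re_Cmult.
  change (Im (RtoC x)) with 0. change (Re (RtoC x)) with x. ring.
Qed.

(** At [v = ln t - ln x] the exponentials of [v] and [- v] become [t / x] and [x / t]. The squared
    logarithm is thus replaced by a combination of t, 1 and 1 / t, whose integrals against t^(x - 1)
    exp(- t) are values of Gamma. *)
Lemma one_minus_cos_ln_le (x y t : R) : 0 < x -> 0 < t ->
  1 - cos (y * (ln t - ln x)) <= 2 * y ^ 2 * (t / x + x / t - 2).
Proof.
  intros Hx Ht.
  pose proof (one_minus_cos_le (y * (ln t - ln x))) as H1.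
  pose proof (sqr_le_cosh (ln t - ln x)) as H2.
  assert (E1 : exp (ln t - ln x) = t / x).
  { unfold Rminus. rewrite exp_plus, exp_Ropp, !exp_ln by auto. reflexivity. }
  assert (E2 : exp (- (ln t - ln x)) = x / t).
  { rewrite exp_Ropp, E1. field. lra. }
  rewrite E1, E2 in H2.
  apply (Rmult_le_compat_l (y ^ 2 / 2)) in H2; [|pose proof (pow2_ge_0 y); lra].
  nra.
Qed.

(* With [x = Re s] and [y = Im s], the real part of [x^(- i y) Gamma(s)] is the
   integral of [t^(x - 1) exp (- t) cos (y ln (t / x))]; the weight concentrates
   near [t = x], where the cosine is close to 1. *)
Lemma EulerGamma_neq_0_large (s : C) :
  1 + 2 * Im s ^ 2 < Re s -> EulerGamma s <> RtoC 0.
Proof.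
  intros Hs H0. set (x := Re s) in *. set (y := Im s) in *.
  pose proof (pow2_ge_0 y) as Hy.
  assert (Hx : 0 < Re s) by (fold x; lra).
  pose proof (is_RInt_gen_EulerGamma s Hx) as G. rewrite H0 in G.
  pose proof (is_RInt_gen_Re _ _ _ _ G) as Gr. pose proof (is_RInt_gen_Im _ _ _ _ G) as Gi.
  change (Re (RtoC 0)) with 0 in Gr. change (Im (RtoC 0)) with 0 in Gi. fold x in Hx.
  (* The weights [cos (y ln x)] and [sin (y ln x)] implement multiplication by x^(- i y) followed by
     the real part; the value is 0 because Gamma(s) is assumed to vanish. *)
  pose proof (is_RInt_gen_plus (V := R_NormedModule) _ _ _ _
    (is_RInt_gen_scal (V := R_NormedModule) _ (cos (y * ln x)) _ Gr)
    (is_RInt_gen_scal (V := R_NormedModule) _ (sin (y * ln x)) _ Gi)) as U.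
  pose proof (gamma_real x Hx) as J0.
  pose proof (gamma_real (x + 1) ltac:(lra)) as J1.
  pose proof (gamma_real (x - 1) ltac:(lra)) as J2.
  pose proof (Re_EulerGamma_succ x Hx) as E1.
  pose proof (Re_EulerGamma_succ (x - 1) ltac:(lra)) as E2.
  replace (x - 1 + 1) with x in E2 by ring.
  (* Integral of the minorant t^(x - 1) exp(- t) (1 - 2 y^2 (t / x - 2 + x / t)); the term x / t
     calls for Gamma(x - 1), hence for x > 1. *)
  pose proof (is_RInt_gen_minus (V := R_NormedModule) _ _ _ _ J0
    (is_RInt_gen_scal (V := R_NormedModule) _ (2 * y ^ 2) _
      (is_RInt_gen_plus (V := R_NormedModule) _ _ _ _
        (is_RInt_gen_minus (V := R_NormedModule) _ _ _ _
          (is_RInt_gen_scal (V := R_NormedModule) _ (/ x) _ J1)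
          (is_RInt_gen_scal (V := R_NormedModule) _ 2 _ J0))
        (is_RInt_gen_scal (V := R_NormedModule) _ x _ J2)))) as L.
  set (A := Re (EulerGamma (RtoC x))) in *.
  set (B := Re (EulerGamma (RtoC (x - 1)))) in *.
  assert (HB : 0 < B).
  { refine (is_RInt_gen_gt_0 (fun t => 0 < t) _ _ interval_ends_pos _ _ _ _ J2).
    - intros t Ht. apply (ex_derive_continuous (K := R_AbsRing) (V := R_NormedModule)).
      auto_derive. auto.
    - intros t Ht. rewrite <- exp_plus. apply exp_pos. }
  assert (Hle : A - 2 * y ^ 2 * (/ x * (x * A) - 2 * A + x * B) <= 0).
  { rewrite <- E1.
    replace 0 with (cos (y * ln x) * 0 + sin (y * ln x) * 0) by ring.
    apply (is_RInt_gen_le (fun t => 0 < t) _ _ interval_ends_pos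
      (fun t => exp ((x - 1) * ln t) * exp (- t) - 2 * y ^ 2 *
        (/ x * (exp ((x + 1 - 1) * ln t) * exp (- t)) - 2 * (exp ((x - 1) * ln t) * exp (- t))
         + x * (exp ((x - 1 - 1) * ln t) * exp (- t))))
      (fun t => cos (y * ln x) * Re (gamma_integrand s t)
         + sin (y * ln x) * Im (gamma_integrand s t))); [|exact L|exact U].
    - intros t Ht.
      rewrite Re_gamma_integrand, Im_gamma_integrand. fold x y.
      pose proof (one_minus_cos_ln_le x y t Hx Ht) as Hc.
      rewrite Rmult_minus_distr_l, cos_minus in Hc.
      replace (x + 1 - 1) with x by ring.
      rewrite <- (exp_pow_ln_S x t Ht), <- (exp_pow_ln_S (x - 1) t Ht).
      set (e := exp ((x - 1 - 1) * ln t)).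
      assert (He : 0 < e * t * exp (- t)).
      { repeat apply Rmult_lt_0_compat; auto; apply exp_pos. }
      apply (Rmult_le_compat_l (e * t * exp (- t))) in Hc; [|lra].
      replace (e * t * exp (- t) * (2 * y ^ 2 * (t / x + x / t - 2)))
        with (2 * y ^ 2 * (/ x * (e * t * t * exp (- t)) - 2 * (e * t * exp (- t))
          + x * (e * exp (- t)))) in Hc by (field; lra).
      lra. }
  (* With A = (x - 1) B the bracket A - 2 A + x B equals B, so the minorant integrates to B (x - 1 -
     2 y^2). This is the origin of the region [1 + 2 * Im s ^ 2 < Re s]. *)
  rewrite E2 in Hle.
  replace ((x - 1) * B - 2 * y ^ 2 * (/ x * (x * ((x - 1) * B)) - 2 * ((x - 1) * B) + x * B))
    with (B * (x - 1 - 2 * y ^ 2)) in Hle by (field; lra).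
  assert (0 < B * (x - 1 - 2 * y ^ 2)) by (apply Rmult_lt_0_compat; lra).
  lra.
Qed.

(** Translation by [n] keeps the imaginary part and, by the functional equation, carries a zero to a
    zero; for large [n] it enters the region already excluded. *)
Lemma EulerGamma_neq_0 (s : C) : 0 < Re s -> EulerGamma s <> RtoC 0.
Proof.
  intros Hs H0.
  destruct (INR_unbounded (1 + 2 * Im s ^ 2)) as [n Hn].
  apply (EulerGamma_neq_0_large (s + RtoC (INR n))%C).
  - rewrite Re_plus_RtoC, Im_plus_RtoC. lra.
  - rewrite EulerGamma_rising, H0 by auto. apply Cmult_0_r.
Qed.

Lemma CGamma_EulerGamma (s : C) : 0 < Re s -> CGamma s = EulerGamma s.
Proof.
  intros Hs. unfold CGamma, gamma_shift.
  (* Since [up r <= r + 1], the integer [up (- Re s)] is below 1, so no shift takes place. *)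
  assert (H : (up (- Re s) <= 0)%Z).
  { destruct (archimed (- Re s)) as [_ H].
    assert (H1 : IZR (up (- Re s)) < IZR 1) by lra.
    apply lt_IZR in H1. lia. }
  replace (Z.to_nat (up (- Re s))) with 0%nat by lia. simpl.
  rewrite Cplus_0_r. unfold Cdiv. replace (/ RtoC 1)%C with (RtoC 1).
  - apply Cmult_1_r.
  - field.
Qed.

Lemma pochhammer_rising (s : C) (n : nat) : 0 < Re s -> pochhammer s n = rising s n.
Proof.
  intros Hs. destruct n as [|n]; [reflexivity|].
  unfold pochhammer. rewrite !CGamma_EulerGamma, EulerGamma_rising; auto.
  - field. now apply EulerGamma_neq_0.
  - rewrite Re_plus_RtoC. pose proof (pos_INR (S n)). lra.
Qed.

(** * The beta function *)

Lemma filterlim_one_minus_at_left_1 :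
  filterlim (fun t => 1 - t) (at_left 1) (at_right 0).
Proof.
  intros P [e He]. exists e. intros y Hy Hy1. apply He; [|lra].
  revert Hy. unfold ball; simpl. unfold AbsRing_ball, abs, minus, plus, opp; simpl.
  replace (1 - y + - 0) with (- (y + - 1)) by ring. now rewrite Rabs_Ropp.
Qed.

Lemma filterlim_of_continuous (F : (R -> Prop) -> Prop) (x : R) (f : R -> R) :
  filter_le F (locally x) -> ex_derive f x -> filterlim f F (locally (f x)).
Proof.
  intros HF Hf. apply (filterlim_filter_le_1 _ HF).
  now apply (ex_derive_continuous (K := R_AbsRing) (V := R_NormedModule)).
Qed.

Lemma exp_pow_ln_le_1 (a t : R) : 0 < a -> 0 < t <= 1 -> exp (a * ln t) <= 1.
Proof.
  intros Ha Ht. rewrite <- exp_0. apply exp_le_exp.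
  assert (H : ln t <= ln 1) by (apply ln_le; lra). rewrite ln_1 in H. nra.
Qed.

(** With U = t^a and V = (1 - t)^c, the quotient U / (U + V) rises from 0 to 1 and has derivative
    t^(a - 1) (1 - t)^(c - 1) (a (1 - t) + c t) / (U + V)^2, which is the beta integrand up to a
    factor bounded below. *)
Lemma beta_dominated (a c : R) (f : R -> R) :
  0 < a -> 0 < c -> (forall t, 0 < t < 1 -> continuous f t) ->
  (forall t, 0 < t < 1 ->
     Rabs (f t) <= exp ((a - 1) * ln t) * exp ((c - 1) * ln (1 - t))) ->
  ex_RInt_gen f (at_right 0) (at_left 1).
Proof.
  intros Ha Hc Hcont Hf.
  set (U := fun t => exp (a * ln t)). set (V := fun t => exp (c * ln (1 - t))).
  (* Here (U + V)^2 <= 4 and a (1 - t) + c t >= min(a, c), so [K] makes the derivative dominate the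
     beta integrand. *)
  set (K := 4 / Rmin a c).
  assert (Hm : 0 < Rmin a c) by now apply Rmin_glb_lt.
  assert (LU0 : filterlim U (at_right 0) (locally 0)) by now apply filterlim_at_right_pow_ln.
  assert (LV1 : filterlim V (at_left 1) (locally 0)).
  { apply (filterlim_comp _ _ _ (fun t => 1 - t) (fun t => exp (c * ln t)) _ (at_right 0)).
    - apply filterlim_one_minus_at_left_1.
    - now apply filterlim_at_right_pow_ln. }
  assert (LU1 : filterlim U (at_left 1) (locally 1)).
  { replace 1 with (U 1) at 2 by (unfold U; rewrite ln_1, Rmult_0_r; apply exp_0).
    apply filterlim_of_continuous; [apply filter_le_within|]. unfold U. auto_derive. lra. }
  assert (LV0 : filterlim V (at_right 0) (locally 1)).
  { replace 1 with (V 0) by (unfold V; rewrite Rminus_0_r, ln_1, Rmult_0_r; apply exp_0).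
    apply filterlim_of_continuous; [apply filter_le_within|]. unfold V. auto_derive. lra. }
  assert (LP : forall (F : (R -> Prop) -> Prop) (FF : Filter F) u v, filterlim U F (locally u) ->
    filterlim V F (locally v) -> u + v <> 0 ->
    filterlim (fun t => K * (U t * / (U t + V t))) F (locally (K * (u * / (u + v))))).
  { intros F FF u v Hu Hv Huv.
    apply (filterlim_comp _ _ _ (fun t => U t * / (U t + V t)) (fun w => K * w) _
      (locally (u * / (u + v)))).
    2: apply (filterlim_scal_r (K := R_AbsRing) (V := R_NormedModule)).
    apply (filterlim_comp_2 U (fun t => / (U t + V t)) Rmult (G := locally u)
      (H := locally (/ (u + v)))); auto.
    2: apply (filterlim_mult (K := R_AbsRing)).
    apply (filterlim_comp _ _ _ (fun t => U t + V t) Rinv _ (locally (u + v))).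
    - apply (filterlim_comp_2 U V Rplus (G := locally u) (H := locally v)); auto.
      apply (filterlim_plus (V := R_NormedModule)).
    - apply (ex_derive_continuous (K := R_AbsRing) (V := R_NormedModule) Rinv (u + v)).
      auto_derive. auto. }
  assert (HUV : forall t, 0 < U t /\ 0 < V t) by (split; apply exp_pos).
  apply (ex_RInt_gen_dominated (fun t => 0 < t < 1) _ _ interval_ends_01 f
    (fun t => K * (U t * / (U t + V t)))
    (fun t => K * (exp ((a - 1) * ln t) * exp ((c - 1) * ln (1 - t)) * (a * (1 - t) + c * t)
               / (U t + V t) ^ 2))
    (K * (0 * / (0 + 1))) (K * (1 * / (1 + 0)))); auto.
  - intros t Ht. destruct (HUV t) as [HU HV]. unfold U, V in *.
    auto_derive.
    + change (1 + - t) with (1 - t). repeat split; lra.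
    + pose proof (exp_pow_ln_S a t ltac:(lra)) as EU.
      pose proof (exp_pow_ln_S c (1 - t) ltac:(lra)) as EV.
      change (1 + - t) with (1 - t) in *. unfold K.
      rewrite <- EU, <- EV in *. field. repeat split; lra.
  - intros t Ht. destruct (HUV t) as [HU HV]. unfold U, V in *.
    apply (ex_derive_continuous (K := R_AbsRing) (V := R_NormedModule)).
    auto_derive. change (1 + - t) with (1 - t). repeat split; try lra. apply Rmult_integral_contrapositive. lra.
  - intros t Ht. eapply Rle_trans; [now apply Hf|].
    destruct (HUV t) as [HU HV].
    assert (HU1 : U t <= 1).
    { apply exp_pow_ln_le_1; lra. }
    assert (HV1 : V t <= 1).
    { apply exp_pow_ln_le_1; lra. }
    set (e := exp ((a - 1) * ln t) * exp ((c - 1) * ln (1 - t))).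
    assert (He : 0 < e) by (apply Rmult_lt_0_compat; apply exp_pos).
    assert (Hmin : Rmin a c <= a * (1 - t) + c * t).
    { pose proof (Rmin_l a c). pose proof (Rmin_r a c). nra. }
    assert (Hs : (U t + V t) ^ 2 <= 4) by nra.
    assert (Hs0 : 0 < (U t + V t) ^ 2) by nra.
    unfold K. replace (4 / Rmin a c * (e * (a * (1 - t) + c * t) / (U t + V t) ^ 2))
      with (e * (4 * / (U t + V t) ^ 2 * ((a * (1 - t) + c * t) / Rmin a c))) by (field; lra).
    rewrite <- (Rmult_1_r e) at 1. apply Rmult_le_compat_l; [lra|].
    rewrite <- (Rmult_1_r 1). apply Rmult_le_compat; try lra.
    + apply (Rmult_le_reg_r ((U t + V t) ^ 2)); auto. rewrite Rmult_assoc, Rinv_l; lra.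
    + apply (Rmult_le_reg_r (Rmin a c)); auto. unfold Rdiv. rewrite Rmult_assoc, Rinv_l; lra.
  - apply LP; auto; try lra. apply filter_filter.
  - apply LP; auto; try lra. apply filter_filter.
Qed.

Lemma beta_boundary (a c : R) (f : R -> R) :
  0 < a -> 0 < c ->
  (forall t, 0 < t < 1 -> Rabs (f t) <= exp (a * ln t) * exp (c * ln (1 - t))) ->
  filterlim f (at_right 0) (locally 0) /\ filterlim f (at_left 1) (locally 0).
Proof.
  intros Ha Hc Hf.
  assert (Hle1 : forall x t, 0 < x -> 0 < t <= 1 -> 0 <= exp (x * ln t) <= 1).
  { intros x t Hx Ht. split; [left; apply exp_pos|].
    now apply exp_pow_ln_le_1. }
  split.
  - apply (filterlim_squeeze_0 _ _ (fun t => exp (a * ln t))).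
    + generalize (ends_left _ _ _ interval_ends_01).
      apply filter_imp. intros t Ht. eapply Rle_trans; [now apply Hf|].
      pose proof (Hle1 c (1 - t) Hc ltac:(lra)). pose proof (Hle1 a t Ha ltac:(lra)). nra.
    + now apply filterlim_at_right_pow_ln.
  - apply (filterlim_squeeze_0 _ _ (fun t => exp (c * ln (1 - t)))).
    + generalize (ends_right _ _ _ interval_ends_01).
      apply filter_imp. intros t Ht. eapply Rle_trans; [now apply Hf|].
      pose proof (Hle1 c (1 - t) Hc ltac:(lra)). pose proof (Hle1 a t Ha ltac:(lra)). nra.
    + apply (filterlim_comp _ _ _ (fun t => 1 - t) (fun t => exp (c * ln t)) _ (at_right 0)).
      * apply filterlim_one_minus_at_left_1.
      * now apply filterlim_at_right_pow_ln.
Qed.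

Local Open Scope C_scope.

Definition beta_integrand (x y : C) (t : R) : C :=
  rcpow t (x - RtoC 1) * rcpow (1 - t) (y - RtoC 1).

Lemma Re_beta_integrand (x y : C) (t : R) :
  Re (beta_integrand x y t)
  = (exp ((Re x - 1) * ln t) * exp ((Re y - 1) * ln (1 - t))
     * cos (Im x * ln t + Im y * ln (1 - t)))%R.
Proof.
  unfold beta_integrand.
  rewrite Re_Cmult, !Re_rcpow, !Im_rcpow, !Re_minus_RtoC, !Im_minus_RtoC, cos_plus. ring.
Qed.

Lemma Im_beta_integrand (x y : C) (t : R) :
  Im (beta_integrand x y t)
  = (exp ((Re x - 1) * ln t) * exp ((Re y - 1) * ln (1 - t))
     * sin (Im x * ln t + Im y * ln (1 - t)))%R.
Proof.
  unfold beta_integrand.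
  rewrite Im_Cmult, !Re_rcpow, !Im_rcpow, !Re_minus_RtoC, !Im_minus_RtoC, sin_plus. ring.
Qed.

Lemma continuous_Re_beta_integrand (x y : C) (t : R) :
  (0 < t < 1)%R -> continuous (fun t => Re (beta_integrand x y t)) t.
Proof.
  intros Ht.
  apply (continuous_ext _ _ _ (fun t => eq_sym (Re_beta_integrand x y t))).
  apply (ex_derive_continuous (K := R_AbsRing) (V := R_NormedModule)).
  auto_derive. repeat split; lra.
Qed.

Lemma continuous_Im_beta_integrand (x y : C) (t : R) :
  (0 < t < 1)%R -> continuous (fun t => Im (beta_integrand x y t)) t.
Proof.
  intros Ht.
  apply (continuous_ext _ _ _ (fun t => eq_sym (Im_beta_integrand x y t))).
  apply (ex_derive_continuous (K := R_AbsRing) (V := R_NormedModule)).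
  auto_derive. repeat split; lra.
Qed.

Lemma is_RInt_gen_CBeta (x y : C) :
  (0 < Re x)%R -> (0 < Re y)%R ->
  @is_RInt_gen C_R_NormedModule (beta_integrand x y) (at_right 0) (at_left 1) (CBeta x y).
Proof.
  intros Hx Hy.
  apply (RInt_gen_correct (V := C_R_CompleteNormedModule)).
  assert (Hr : ex_RInt_gen (fun t => Re (beta_integrand x y t)) (at_right 0) (at_left 1)).
  { apply (beta_dominated (Re x) (Re y)); auto; intros t Ht.
    - now apply continuous_Re_beta_integrand.
    - rewrite Re_beta_integrand, <- exp_plus.
      apply Rabs_mult_le_1; [left; apply exp_pos|apply Rabs_cos_le_1]. }
  assert (Hi : ex_RInt_gen (fun t => Im (beta_integrand x y t)) (at_right 0) (at_left 1)).
  { apply (beta_dominated (Re x) (Re y)); auto; intros t Ht.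
    - now apply continuous_Im_beta_integrand.
    - rewrite Im_beta_integrand, <- exp_plus.
      apply Rabs_mult_le_1; [left; apply exp_pos|apply Rabs_sin_le_1]. }
  destruct Hr as [u Hu], Hi as [v Hv]. exists (u, v).
  apply is_RInt_gen_C; auto; apply filter_filter.
Qed.

(* Integrate the derivative of [t^x (1 - t)^y], which vanishes at both ends. *)
Lemma CBeta_succ (x y : C) :
  (0 < Re x)%R -> (0 < Re y)%R -> x * CBeta x y = (x + y) * CBeta (x + RtoC 1) y.
Proof.
  intros Hx Hy.
  assert (Hx1 : (0 < Re (x + RtoC 1))%R) by (rewrite Re_plus_RtoC; lra).
  destruct (beta_boundary (Re x) (Re y)
    (fun t => exp (Re x * ln t) * exp (Re y * ln (1 - t))
       * cos (Im x * ln t + Im y * ln (1 - t)))%R) as [Lc0 Lc1]; [exact Hx | exact Hy | |].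
  { intros t Ht. rewrite <- exp_plus.
    apply Rabs_mult_le_1; [left; apply exp_pos|apply Rabs_cos_le_1]. }
  destruct (beta_boundary (Re x) (Re y)
    (fun t => exp (Re x * ln t) * exp (Re y * ln (1 - t))
       * sin (Im x * ln t + Im y * ln (1 - t)))%R) as [Ls0 Ls1]; [exact Hx | exact Hy | |].
  { intros t Ht. rewrite <- exp_plus.
    apply Rabs_mult_le_1; [left; apply exp_pos|apply Rabs_sin_le_1]. }
  apply (is_RInt_gen_Cmult_eq (fun t => 0 < t < 1)%R _ _ interval_ends_01
    (beta_integrand x y) (beta_integrand (x + RtoC 1) y)
    (fun t => exp (Re x * ln t) * exp (Re y * ln (1 - t))
       * cos (Im x * ln t + Im y * ln (1 - t)))%R
    (fun t => exp (Re x * ln t) * exp (Re y * ln (1 - t))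
       * sin (Im x * ln t + Im y * ln (1 - t)))%R).
  1, 2: now apply is_RInt_gen_CBeta.
  3, 5: apply continuous_Re_beta_integrand.
  3, 4: apply continuous_Im_beta_integrand.
  3, 4, 5, 6: assumption.
  all: intros t Ht.
  - change (Re (x * beta_integrand x y t - (x + y) * beta_integrand (x + RtoC 1) y t))
      with (Re x * Re (beta_integrand x y t) - Im x * Im (beta_integrand x y t)
            - ((Re x + Re y) * Re (beta_integrand (x + RtoC 1) y t)
               - (Im x + Im y) * Im (beta_integrand (x + RtoC 1) y t)))%R.
    rewrite !Re_beta_integrand, !Im_beta_integrand, Re_plus_RtoC, Im_plus_RtoC.
    replace (Re x + 1 - 1)%R with (Re x) by ring.
    auto_derive; [repeat split; lra|]. change (1 + - t)%R with (1 - t)%R.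
    rewrite <- (exp_pow_ln_S (Re x) t), <- (exp_pow_ln_S (Re y) (1 - t)) by lra.
    field. lra.
  - change (Im (x * beta_integrand x y t - (x + y) * beta_integrand (x + RtoC 1) y t))
      with (Re x * Im (beta_integrand x y t) + Im x * Re (beta_integrand x y t)
            - ((Re x + Re y) * Im (beta_integrand (x + RtoC 1) y t)
               + (Im x + Im y) * Re (beta_integrand (x + RtoC 1) y t)))%R.
    rewrite !Re_beta_integrand, !Im_beta_integrand, Re_plus_RtoC, Im_plus_RtoC.
    replace (Re x + 1 - 1)%R with (Re x) by ring.
    auto_derive; [repeat split; lra|]. change (1 + - t)%R with (1 - t)%R.
    rewrite <- (exp_pow_ln_S (Re x) t), <- (exp_pow_ln_S (Re y) (1 - t)) by lra.
    field. lra.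
Qed.

Lemma C_neq_0_Re (s : C) : (0 < Re s)%R -> s <> RtoC 0.
Proof. intros H ->. simpl in H. lra. Qed.

Lemma rising_neq_0 (s : C) (n : nat) : (0 < Re s)%R -> rising s n <> RtoC 0.
Proof.
  intros Hs. induction n as [|n IH]; simpl.
  - apply C_neq_0_Re. simpl. lra.
  - apply Cmult_neq_0; auto. apply C_neq_0_Re. rewrite Re_plus_RtoC.
    pose proof (pos_INR n). lra.
Qed.

Lemma CBeta_rising (x y : C) (n : nat) :
  (0 < Re x)%R -> (0 < Re y)%R ->
  rising x n * CBeta x y = rising (x + y) n * CBeta (x + RtoC (INR n)) y.
Proof.
  intros Hx Hy. induction n as [|n IH].
  - simpl. now rewrite Cplus_0_r.
  - rewrite S_INR, RtoC_plus, Cplus_assoc. simpl.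
    transitivity ((x + RtoC (INR n)) * (rising x n * CBeta x y)); [ring|].
    rewrite IH.
    transitivity (rising (x + y) n * ((x + RtoC (INR n)) * CBeta (x + RtoC (INR n)) y)); [ring|].
    rewrite CBeta_succ; [ring| |exact Hy].
    rewrite Re_plus_RtoC. pose proof (pos_INR n). lra.
Qed.

(** * Boundedness of the moments *)

Local Open Scope R_scope.

Lemma pow_diff_bounds (m : nat) (x y : R) :
  0 <= x <= y -> y <= 1 -> 0 <= y ^ m - x ^ m <= INR m * (y - x).
Proof.
  intros Hx Hy. induction m as [|m IH].
  - simpl. lra.
  - rewrite S_INR. simpl.
    assert (0 <= x ^ m <= 1).
    { split; [apply pow_le; lra|]. rewrite <- (pow1 m). apply pow_incr. lra. }
    replace (y * y ^ m - x * x ^ m) with (y * (y ^ m - x ^ m) + x ^ m * (y - x)) by ring.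
    nra.
Qed.

(* Summing over a subdivision of mesh [(b - a) / N], the quadratic terms contribute
   [O(1 / N)]. *)
Lemma increment_le_of_quadratic (H phi : R -> R) (a b M : R) :
  a <= b ->
  (forall x y, a <= x <= y -> y <= b ->
     Rabs (H y - H x) <= M * (y - x) ^ 2 + (phi y - phi x)) ->
  Rabs (H b - H a) <= phi b - phi a.
Proof.
  intros Hab HH.
  assert (Hn : forall n : nat, Rabs (H b - H a) <= Rabs M * (b - a) ^ 2 / INR (S n) + (phi b - phi a)).
  { intros n. set (h := (b - a) / INR (S n)).
    assert (HS : 0 < INR (S n)) by (apply lt_0_INR; lia).
    assert (Hh : 0 <= h) by (apply Rmult_le_pos; [lra|left; now apply Rinv_0_lt_compat]).
    assert (E : INR (S n) * h = b - a) by (unfold h; field; lra).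
    assert (Hk : forall k : nat, (k <= S n)%nat ->
      Rabs (H (a + INR k * h) - H a) <= INR k * (Rabs M * h ^ 2) + (phi (a + INR k * h) - phi a)).
    { induction k as [|k IH]; intros Hk.
      - simpl. rewrite !Rmult_0_l, !Rplus_0_r, !Rminus_diag, Rabs_R0. lra.
      - specialize (IH ltac:(lia)).
        assert (Hle : INR (S k) * h <= INR (S n) * h).
        { apply Rmult_le_compat_r; auto. now apply le_INR. }
        pose proof (pos_INR k).
        assert (0 <= INR k * h) by now apply Rmult_le_pos.
        rewrite (S_INR k) in *.
        specialize (HH (a + INR k * h) (a + (INR k + 1) * h) ltac:(lra) ltac:(lra)).
        replace (a + (INR k + 1) * h - (a + INR k * h)) with h in HH by ring.
        replace (H (a + (INR k + 1) * h) - H a)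
          with (H (a + (INR k + 1) * h) - H (a + INR k * h) + (H (a + INR k * h) - H a)) by ring.
        eapply Rle_trans; [apply Rabs_triang|].
        assert (M * h ^ 2 <= Rabs M * h ^ 2).
        { apply Rmult_le_compat_r; [apply pow2_ge_0|apply Rle_abs]. }
        lra. }
    specialize (Hk (S n) ltac:(lia)). rewrite E in Hk.
    replace (a + (b - a)) with b in Hk by ring.
    replace (Rabs M * (b - a) ^ 2 / INR (S n)) with (INR (S n) * (Rabs M * h ^ 2)); auto.
    unfold h. field. lra. }
  apply Rle_plus_epsilon. intros eps Heps.
  set (Q := Rabs M * (b - a) ^ 2).
  assert (HQ : 0 <= Q) by (apply Rmult_le_pos; [apply Rabs_pos|apply pow2_ge_0]).
  destruct (INR_unbounded (Q / eps)) as [n Hn'].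
  specialize (Hn n). fold Q in Hn.
  assert (HS : 0 < INR (S n)) by (apply lt_0_INR; lia).
  assert (Q / INR (S n) <= eps).
  { apply (Rmult_le_reg_r (INR (S n))); auto.
    unfold Rdiv. rewrite Rmult_assoc, Rinv_l, Rmult_1_r by lra.
    apply Rgt_lt in Hn'. apply (Rmult_lt_compat_r eps) in Hn'; auto.
    unfold Rdiv in Hn'. rewrite Rmult_assoc, Rinv_l, Rmult_1_r in Hn' by lra.
    rewrite S_INR. lra. }
  lra.
Qed.

(** A form of the second mean value theorem: integration by parts against the monotone t^m, with a
    bound independent of [m]. As [g] is merely Riemann integrable, its primitive need not be
    differentiable, and increments over short segments replace derivatives. *)
Lemma RInt_pow_mult_bound (g : R -> R) (m : nat) (a b K : R) :
  0 <= a <= b -> b <= 1 ->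
  ex_RInt g a b -> ex_RInt (fun t => t ^ m * g t) a b ->
  (forall x, a <= x <= b -> Rabs (RInt g a x) <= K) ->
  Rabs (RInt (fun t => t ^ m * g t) a b) <= 2 * K.
Proof.
  intros Ha Hb Hg Hfg HK.
  assert (Hsub : forall (f : R -> R) x y, ex_RInt f a b -> a <= x <= y -> y <= b -> ex_RInt f x y).
  { intros f x y Hf Hx Hy.
    apply (ex_RInt_Chasles_2 (V := R_CompleteNormedModule) f a); [lra|].
    apply (ex_RInt_Chasles_1 (V := R_CompleteNormedModule) f a y b); [lra|auto]. }
  destruct (ex_RInt_ub (V := R_NormedModule) g a b Hg) as [M HM].
  rewrite Rmin_left, Rmax_right in HM by lra.
  assert (HM' : forall t, a <= t <= b -> Rabs (g t) <= M) by exact HM. clear HM.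
  (* With G(t) the integral of [g] from [a] to [t], [H x] is minus the Stieltjes integral of G
     against d(t^m) from [a] to [x]; since [|G| <= K], the expected bound is K (b^m - a^m). *)
  set (H := fun x => RInt (fun t => t ^ m * g t) a x - x ^ m * RInt g a x).
  assert (HH : Rabs (H b - H a) <= K * b ^ m - K * a ^ m).
  { apply (increment_le_of_quadratic H (fun x => K * x ^ m) a b (INR m * M)); [lra|].
    intros x y Hx Hy. pose proof (pow_diff_bounds m x y ltac:(lra) ltac:(lra)) as Hp.
    (* The first term is quadratic in [y - x]: both t^m - y^m and the length of the segment are of
       that order, and [g] is bounded by [M]. The second is at most K (y^m - x^m). *)
    assert (E : H y - H x = RInt (fun t => (t ^ m - y ^ m) * g t) x y
                            - (y ^ m - x ^ m) * RInt g a x).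
    { unfold H.
      rewrite <- (RInt_Chasles (V := R_CompleteNormedModule) g a x y) by (apply Hsub; auto; lra).
      rewrite <- (RInt_Chasles (V := R_CompleteNormedModule) (fun t => t ^ m * g t) a x y)
        by (apply Hsub; auto; lra).
      rewrite (RInt_ext (fun t => (t ^ m - y ^ m) * g t)
        (fun t => minus (t ^ m * g t) (scal (y ^ m) (g t)))).
      - rewrite (RInt_minus (V := R_CompleteNormedModule) (fun t => t ^ m * g t)
          (fun t => scal (y ^ m) (g t))).
        + rewrite (RInt_scal (V := R_CompleteNormedModule)) by (apply Hsub; auto; lra).
          unfold minus, plus, opp, scal; simpl. unfold mult; simpl. ring.
        + apply Hsub; auto; lra.
        + apply (ex_RInt_scal (V := R_NormedModule)). apply Hsub; auto; lra.
      - intros t _. unfold minus, plus, opp, scal; simpl. unfold mult; simpl. ring. }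
    rewrite E. clear E.
    assert (H1 : Rabs (RInt (fun t => (t ^ m - y ^ m) * g t) x y)
                 <= (y - x) * (INR m * (y - x) * M)).
    { apply abs_RInt_le_const; [lra| |].
      - apply (ex_RInt_ext (fun t => minus (t ^ m * g t) (scal (y ^ m) (g t)))).
        + intros t _. unfold minus, plus, opp, scal; simpl. unfold mult; simpl. ring.
        + apply (ex_RInt_minus (V := R_NormedModule)).
          * apply Hsub; auto; lra.
          * apply (ex_RInt_scal (V := R_NormedModule)). apply Hsub; auto; lra.
      - intros t Ht. rewrite Rabs_mult.
        apply Rmult_le_compat; try apply Rabs_pos; [|apply HM'; lra].
        pose proof (pow_diff_bounds m t y ltac:(lra) ltac:(lra)) as Hp'.
        rewrite Rabs_minus_sym, Rabs_pos_eq by lra.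
        pose proof (pos_INR m). nra. }
    assert (H2 : Rabs ((y ^ m - x ^ m) * RInt g a x) <= (y ^ m - x ^ m) * K).
    { rewrite Rabs_mult, (Rabs_pos_eq (y ^ m - x ^ m)) by lra.
      apply Rmult_le_compat_l; [lra|]. apply HK. lra. }
    unfold Rminus at 1. eapply Rle_trans; [apply Rabs_triang|]. rewrite Rabs_Ropp. nra. }
  assert (Ea : H a = 0).
  { unfold H. rewrite !(RInt_point (V := R_CompleteNormedModule)).
    change (0 - a ^ m * 0 = 0). ring. }
  rewrite Ea, Rminus_0_r in HH.
  assert (HK0 : 0 <= K) by (eapply Rle_trans; [apply Rabs_pos|apply (HK a); lra]).
  pose proof (HK b ltac:(lra)) as HKb.
  assert (Hbm : 0 <= b ^ m <= 1).
  { split; [apply pow_le; lra|]. rewrite <- (pow1 m). apply pow_incr. lra. }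
  pose proof (pow_le a m ltac:(lra)).
  replace (RInt (fun t => t ^ m * g t) a b) with (H b + b ^ m * RInt g a b) by (unfold H; ring).
  eapply Rle_trans; [apply Rabs_triang|].
  rewrite Rabs_mult, (Rabs_pos_eq (b ^ m)) by lra.
  assert (K * b ^ m <= K) by nra. assert (0 <= K * a ^ m) by nra.
  assert (b ^ m * Rabs (RInt g a b) <= 1 * K)
    by (apply Rmult_le_compat; auto; [lra|apply Rabs_pos|lra]).
  lra.
Qed.

(** The limit is unfolded with tolerance 1 and a single radius for both ends. One inequality bounds
    partial integrals by the limit, the other transfers a bound on partial integrals back to it. *)
Lemma is_RInt_gen_01_local (g : R -> R) (l : R) :
  is_RInt_gen g (at_right 0) (at_left 1) l ->
  exists d, 0 < d < / 2 /\ forall a b, 0 < a < d -> 1 - d < b < 1 ->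
    ex_RInt g a b /\ Rabs (RInt g a b) <= Rabs l + 1 /\ Rabs l <= Rabs (RInt g a b) + 1.
Proof.
  intros Hg.
  destruct (Hg _ (locally_ball l (mkposreal 1 Rlt_0_1))) as [Q S [e He] [e' He'] HQS].
  pose proof (cond_pos e). pose proof (cond_pos e').
  (* The cap 1/4 keeps the neighbourhoods of the two ends disjoint. *)
  exists (Rmin (/ 4) (Rmin e e')).
  assert (Hd : 0 < Rmin (/ 4) (Rmin e e')) by (repeat apply Rmin_glb_lt; lra).
  pose proof (Rmin_l (/ 4) (Rmin e e')). pose proof (Rmin_r (/ 4) (Rmin e e')).
  pose proof (Rmin_l e e'). pose proof (Rmin_r e e').
  split; [lra|]. intros a b Ha Hb.
  destruct (HQS a b) as [y [Hy Hly]].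
  - apply He; [|lra]. unfold ball; simpl. unfold AbsRing_ball, abs, minus, plus, opp; simpl.
    apply Rabs_lt_between. lra.
  - apply He'; [|lra]. unfold ball; simpl. unfold AbsRing_ball, abs, minus, plus, opp; simpl.
    apply Rabs_lt_between. lra.
  - simpl in Hy. split; [now exists y|].
    rewrite (is_RInt_unique (V := R_CompleteNormedModule) _ _ _ _ Hy).
    revert Hly. unfold ball; simpl. unfold AbsRing_ball, abs, minus, plus, opp; simpl.
    unfold Rabs. repeat destruct Rcase_abs; lra.
Qed.

Lemma is_RInt_gen_01_ex_RInt (g : R -> R) (l a b : R) :
  is_RInt_gen g (at_right 0) (at_left 1) l -> 0 < a <= b -> b < 1 -> ex_RInt g a b.
Proof.
  intros Hg Ha Hb. destruct (is_RInt_gen_01_local g l Hg) as [d [Hd H]].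
  assert (Hc : 0 < Rmin a d) by (apply Rmin_glb_lt; lra).
  assert (Hc' : 0 < Rmin (1 - b) d) by (apply Rmin_glb_lt; lra).
  pose proof (Rmin_l a d). pose proof (Rmin_r a d).
  pose proof (Rmin_l (1 - b) d). pose proof (Rmin_r (1 - b) d).
  destruct (H (Rmin a d / 2) (1 - Rmin (1 - b) d / 2)) as [Hex _]; try lra.
  apply (ex_RInt_Chasles_2 (V := R_CompleteNormedModule) g (Rmin a d / 2)); [lra|].
  apply (ex_RInt_Chasles_1 (V := R_CompleteNormedModule) g _ b (1 - Rmin (1 - b) d / 2)); [lra|auto].
Qed.

Lemma is_RInt_gen_01_bounded (g : R -> R) (l : R) :
  is_RInt_gen g (at_right 0) (at_left 1) l ->
  exists K, forall a b, 0 < a <= b -> b < 1 -> Rabs (RInt g a b) <= K.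
Proof.
  intros Hg. pose proof (fun a b => is_RInt_gen_01_ex_RInt g l a b Hg) as Hex.
  destruct (is_RInt_gen_01_local g l Hg) as [d [Hd H]].
  set (c := d / 2).
  destruct (ex_RInt_ub (V := R_NormedModule) g c (1 - c)) as [M HM].
  { apply Hex; unfold c; lra. }
  rewrite Rmin_left, Rmax_right in HM by (unfold c; lra).
  assert (HM0 : 0 <= M).
  { apply (Rle_trans _ (Rabs (g c))); [apply Rabs_pos|]. apply (HM c). unfold c; lra. }
  (* [B] covers three positions of [x]: near 0 the integral is a difference of two that reach close
     to both ends, in the middle [|g| <= M] on a length below 1, and near 1 the limit controls it
     directly. *)
  set (B := Rabs l + 1 + (Rabs l + 1) + M).
  pose proof (Rabs_pos l).
  assert (HB : forall x, 0 < x < 1 -> Rabs (RInt g c x) <= B).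
  { intros x Hx. unfold B. destruct (Rlt_le_dec x c) as [Hxc | Hxc].
    - assert (E : RInt g c x = RInt g c (1 - c) - RInt g x (1 - c)).
      { rewrite <- (RInt_Chasles (V := R_CompleteNormedModule) g x c (1 - c))
          by (apply Hex; unfold c in *; lra).
        rewrite <- (opp_RInt_swap (V := R_CompleteNormedModule))
          by (apply Hex; unfold c in *; lra).
        unfold opp, plus; simpl. ring. }
      rewrite E. unfold Rminus at 1. eapply Rle_trans; [apply Rabs_triang|]. rewrite Rabs_Ropp.
      destruct (H c (1 - c)) as [_ [H1 _]]; try (unfold c; lra).
      destruct (H x (1 - c)) as [_ [H2 _]]; try (unfold c in *; lra).
    - destruct (Rlt_le_dec x (1 - c)) as [Hx1 | Hx1].
      + eapply Rle_trans.
        * apply (abs_RInt_le_const g c x M); auto.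
          -- apply Hex; unfold c in *; lra.
          -- intros t Ht. apply HM. lra.
        * unfold c in *. nra.
      + destruct (H c x) as [_ [H1 _]]; try (unfold c in *; lra). }
  exists (B + B). intros a b Ha Hb.
  assert (Hex' : forall a b, 0 < a < 1 -> 0 < b < 1 -> ex_RInt g a b).
  { intros u v Hu Hv. destruct (Rle_dec u v); [apply Hex; lra|].
    apply (ex_RInt_swap (V := R_NormedModule)). apply Hex; lra. }
  assert (E : RInt g a b = RInt g c b - RInt g c a).
  { rewrite <- (RInt_Chasles (V := R_CompleteNormedModule) g c a b)
      by (apply Hex'; unfold c in *; lra).
    symmetry. apply Rplus_minus_l. }
  rewrite E. unfold Rminus at 1. eapply Rle_trans; [apply Rabs_triang|]. rewrite Rabs_Ropp.
  apply Rplus_le_compat; apply HB; lra.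
Qed.

(* The integrals may converge only conditionally, so the bound rests on the
   monotonicity of [t^m] rather than on the integrability of [Rabs g]. *)
Lemma moments_bounded (g : R -> R) (l : nat -> R) :
  (forall m, is_RInt_gen (fun t => t ^ m * g t) (at_right 0) (at_left 1) (l m)) ->
  exists K, forall m, Rabs (l m) <= K.
Proof.
  intros Hl.
  assert (Hg : is_RInt_gen g (at_right 0) (at_left 1) (l 0%nat)).
  { apply (is_RInt_gen_ext_in (fun t => 0 < t < 1) _ _ interval_ends_01 (fun t => t ^ 0 * g t)).
    - intros t _. simpl. ring.
    - apply Hl. }
  destruct (is_RInt_gen_01_bounded g _ Hg) as [K HK].
  exists (2 * K + 1). intros m.
  (* The radius [d] depends on [m], but [K] bounds the integrals of [g] over all segments, so the
     final bound is uniform. *)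
  destruct (is_RInt_gen_01_local _ _ (Hl m)) as [d [Hd H]].
  destruct (H (d / 2) (1 - d / 2)) as [Hex [_ Hle]]; try lra.
  eapply Rle_trans; [apply Hle|]. apply Rplus_le_compat_r.
  apply RInt_pow_mult_bound; auto; try lra.
  - apply (is_RInt_gen_01_ex_RInt g _ _ _ Hg); lra.
  - intros x Hx. apply HK; lra.
Qed.

(** * Uniform bound on the M-beta numerators *)

Local Open Scope C_scope.

Lemma rcpow_plus_INR (t : R) (s : C) (m : nat) :
  (0 < t)%R -> rcpow t (s + RtoC (INR m)) = rcpow t s * RtoC (t ^ m).
Proof.
  intros Ht. rewrite <- (Rpower_pow m t Ht). unfold Rpower.
  apply C_eq.
  - rewrite Re_mult_RtoC, !Re_rcpow, Re_plus_RtoC, Im_plus_RtoC, Rmult_plus_distr_r, exp_plus. ring.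
  - rewrite Im_mult_RtoC, !Im_rcpow, Re_plus_RtoC, Im_plus_RtoC, Rmult_plus_distr_r, exp_plus. ring.
Qed.

Lemma Cmod_le_Re_Im (c : C) : (Cmod c <= Rabs (Re c) + Rabs (Im c))%R.
Proof.
  assert (E : c = RtoC (Re c) + Ci * RtoC (Im c)).
  { apply C_eq; unfold Re, Im; simpl; ring. }
  rewrite E at 1. eapply Rle_trans; [apply Cmod_triangle|].
  rewrite Cmod_mult, !Cmod_R, Cmod_Ci. lra.
Qed.

Lemma MBeta_bounded (kappa mu : list C) (alpha beta l2 y rho : C) :
  (forall n, MBeta_defined kappa mu alpha beta (l2 + RtoC (INR n)) y rho) ->
  exists K, forall n, (Cmod (MBeta kappa mu alpha beta (l2 + RtoC (INR n)) y rho) <= K)%R.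
Proof.
  intros Hdef.
  set (g := MBeta_integrand kappa mu alpha beta l2 y rho).
  assert (Hint : forall n, @is_RInt_gen C_R_NormedModule
    (MBeta_integrand kappa mu alpha beta (l2 + RtoC (INR n)) y rho) (at_right 0) (at_left 1)
    (MBeta kappa mu alpha beta (l2 + RtoC (INR n)) y rho)).
  { intros n. apply (RInt_gen_correct (V := C_R_CompleteNormedModule)). apply Hdef. }
  assert (E : forall n t, (0 < t < 1)%R ->
    MBeta_integrand kappa mu alpha beta (l2 + RtoC (INR n)) y rho t = g t * RtoC (t ^ n)).
  { intros n t Ht. unfold g, MBeta_integrand.
    replace (l2 + RtoC (INR n) - RtoC 1) with (l2 - RtoC 1 + RtoC (INR n)) by ring.
    rewrite rcpow_plus_INR by lra. ring. }
  (* Since t^n is real, the real and imaginary parts of the numerators are moments of the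
     corresponding parts of [g]. *)
  destruct (moments_bounded (fun t => Re (g t))
    (fun n => Re (MBeta kappa mu alpha beta (l2 + RtoC (INR n)) y rho))) as [K HK].
  { intros n.
    apply (is_RInt_gen_ext_in (fun t => 0 < t < 1)%R _ _ interval_ends_01
      (fun t => Re (MBeta_integrand kappa mu alpha beta (l2 + RtoC (INR n)) y rho t))).
    - intros t Ht. rewrite E, Re_mult_RtoC by auto. ring.
    - apply is_RInt_gen_Re, Hint. }
  destruct (moments_bounded (fun t => Im (g t))
    (fun n => Im (MBeta kappa mu alpha beta (l2 + RtoC (INR n)) y rho))) as [K' HK'].
  { intros n.
    apply (is_RInt_gen_ext_in (fun t => 0 < t < 1)%R _ _ interval_ends_01
      (fun t => Im (MBeta_integrand kappa mu alpha beta (l2 + RtoC (INR n)) y rho t))).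
    - intros t Ht. rewrite E, Im_mult_RtoC by auto. ring.
    - apply is_RInt_gen_Im, Hint. }
  exists (K + K')%R. intros n. eapply Rle_trans; [apply Cmod_le_Re_Im|].
  now apply Rplus_le_compat.
Qed.

(** * Complex exponential generating functions *)

Lemma is_series_CSeries (a : nat -> C) (l : C) :
  @is_series C_AbsRing C_NormedModule a l -> CSeries a = l.
Proof.
  intros H.
  assert (Er : forall n, Re (@sum_n C_AbelianMonoid a n) = sum_n (fun k => Re (a k)) n).
  { induction n as [|n IH]; [now rewrite !sum_O|]. rewrite !sum_Sn, <- IH. reflexivity. }
  assert (Ei : forall n, Im (@sum_n C_AbelianMonoid a n) = sum_n (fun k => Im (a k)) n).
  { induction n as [|n IH]; [now rewrite !sum_O|]. rewrite !sum_Sn, <- IH. reflexivity. }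
  apply C_eq.
  - apply is_series_unique. intros P [e He].
    unfold filtermap. apply (filter_imp (F := eventually) (fun n => P (Re (@sum_n C_AbelianMonoid a n)))).
    { intros n. now rewrite Er. }
    apply (H (fun z => P (Re z))). exists e. intros z [Hz _]. now apply He.
  - apply is_series_unique. intros P [e He].
    unfold filtermap. apply (filter_imp (F := eventually) (fun n => P (Im (@sum_n C_AbelianMonoid a n)))).
    { intros n. now rewrite Ei. }
    apply (H (fun z => P (Im z))). exists e. intros z [_ Hz]. now apply He.
Qed.

Lemma CSeries_correct (a : nat -> C) :
  ex_CSeries a -> @is_series C_AbsRing C_NormedModule a (CSeries a).
Proof. intros [l Hl]. now rewrite (is_series_CSeries a l Hl). Qed.

Lemma is_series_Cmod_le (a : nat -> C) (b : nat -> R) (l : C) (s : R) :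
  (forall n, (Cmod (a n) <= b n)%R) ->
  @is_series C_AbsRing C_NormedModule a l -> is_series b s -> (Cmod l <= s)%R.
Proof.
  intros Hab Ha Hb.
  apply (filterlim_le (F := eventually) (fun n => Cmod (@sum_n C_AbelianMonoid a n)) (sum_n b)
    (Finite (Cmod l)) (Finite s)).
  - apply filter_forall. intros n.
    refine (Rle_trans _ _ _ (norm_sum_n_m (K := C_AbsRing) (V := C_NormedModule) a 0 n) _).
    apply sum_n_m_le. exact Hab.
  - apply (filterlim_comp _ _ _ _ _ _ _ _ Ha). apply (filterlim_norm (V := C_NormedModule)).
  - exact Hb.
Qed.

(** Keeping the factorial apart from the coefficient turns differentiation into the shift of [c],
    which preserves a uniform bound on the coefficients. *)
Definition egf_term (c : nat -> C) (w : C) (m : nat) : C :=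
  c m * (@pow_n C_Ring w m / RtoC (INR (fact m))).

Lemma Cmod_pow_n (w : C) (m : nat) : Cmod (@pow_n C_Ring w m) = (Cmod w ^ m)%R.
Proof.
  induction m as [|m IH]; simpl.
  - apply Cmod_1.
  - change (@mult C_Ring w (pow_n w m)) with (w * @pow_n C_Ring w m). now rewrite Cmod_mult, IH.
Qed.

Lemma INR_fact_C_neq_0 (m : nat) : RtoC (INR (fact m)) <> RtoC 0.
Proof. intros E. apply RtoC_inj in E. now apply INR_fact_neq_0 in E. Qed.

Lemma Cmod_div_fact (a : C) (m : nat) :
  Cmod (a / RtoC (INR (fact m))) = (Cmod a / INR (fact m))%R.
Proof.
  rewrite Cmod_div by apply INR_fact_C_neq_0. rewrite Cmod_R, Rabs_pos_eq; auto. apply pos_INR.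
Qed.

Lemma ex_series_exp (x : R) : ex_series (fun m => x ^ m / INR (fact m))%R.
Proof.
  exists (exp x).
  apply (is_series_ext (fun m => scal (pow_n x m) (/ INR (fact m))%R)).
  - intros m. rewrite pow_n_pow. reflexivity.
  - apply is_exp_Reals.
Qed.

Lemma ex_series_egf_term (c : nat -> C) (K : R) (w : C) :
  (forall m, (Cmod (c m) <= K)%R) -> ex_CSeries (egf_term c w).
Proof.
  intros Hc.
  apply (ex_series_le (V := C_CompleteNormedModule) _
    (fun m => K * (Cmod w ^ m / INR (fact m)))%R).
  - intros m. change (norm (egf_term c w m)) with (Cmod (egf_term c w m)).
    unfold egf_term. rewrite Cmod_mult, Cmod_div_fact, Cmod_pow_n.
    apply Rmult_le_compat_r; auto.
    apply Rmult_le_pos; [apply pow_le, Cmod_ge_0|]. left. apply Rinv_0_lt_compat, INR_fact_lt_0.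
  - apply (ex_series_scal_l (K := R_AbsRing) K (fun m => Cmod w ^ m / INR (fact m))%R). apply ex_series_exp.
Qed.

Lemma INR_le_pow_2 (m : nat) : (INR m <= 2 ^ m)%R.
Proof.
  induction m as [|m IH]; [simpl; lra|]. rewrite S_INR. simpl.
  assert (1 <= 2 ^ m)%R by (apply pow_R1_Rle; lra). lra.
Qed.

(** The remainders satisfy r_(k+1) = y r_k + k (y - w)^2 w^(k - 1). The crude factor 2^k absorbs the
    linear growth in k and leaves a bound that is summable against 1 / k!. *)
Lemma pow_n_linearization (w y : C) (R0 : R) (m : nat) :
  (Cmod w <= R0)%R -> (Cmod y <= R0)%R -> (1 <= R0)%R ->
  (Cmod (@pow_n C_Ring y (S m) - @pow_n C_Ring w (S m)
         - RtoC (INR (S m)) * (y - w) * @pow_n C_Ring w m)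
   <= Cmod (y - w) ^ 2 * (2 * R0) ^ S m)%R.
Proof.
  intros Hw Hy HR. induction m as [|m IH].
  - replace (_ - _) with (RtoC 0).
    + rewrite Cmod_0. apply Rmult_le_pos; [apply pow2_ge_0|apply pow_le; lra].
    + simpl. change (@mult C_Ring) with Cmult. change (@one C_Ring) with (RtoC 1). ring.
  - rewrite (S_INR (S m)).
    set (k := INR (S m)) in *. assert (Hk : (0 <= k <= 2 ^ S m)%R).
    { split; [apply pos_INR|apply INR_le_pow_2]. }
    change (@pow_n C_Ring y (S (S m))) with (y * @pow_n C_Ring y (S m)).
    change (@pow_n C_Ring w (S (S m))) with (w * (w * @pow_n C_Ring w m)).
    change (@pow_n C_Ring w (S m)) with (w * @pow_n C_Ring w m) in *.
    set (Y := @pow_n C_Ring y (S m)) in *.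
    assert (HW : (Cmod (@pow_n C_Ring w m) <= R0 ^ m)%R).
    { rewrite Cmod_pow_n. apply pow_incr. split; [apply Cmod_ge_0|auto]. }
    set (W := @pow_n C_Ring w m) in *.
    rewrite RtoC_plus.
    replace (y * Y - w * (w * W) - (RtoC k + RtoC 1) * (y - w) * (w * W))
      with (y * (Y - w * W - RtoC k * (y - w) * W) + RtoC k * ((y - w) * (y - w)) * W) by ring.
    eapply Rle_trans; [apply Cmod_triangle|]. rewrite !Cmod_mult, Cmod_R, Rabs_pos_eq by lra.
    set (h := Cmod (y - w)) in *. assert (Hh : (0 <= h)%R) by apply Cmod_ge_0.
    assert (Hp : (0 <= R0 ^ m)%R) by (apply pow_le; lra).
    assert (H2 : (0 <= 2 ^ S m)%R) by (apply pow_le; lra).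
    rewrite Rpow_mult_distr in *.
    assert (H1 : (Cmod y * Cmod (Y - w * W - RtoC k * (y - w) * W)
                  <= R0 * (h ^ 2 * (2 ^ S m * R0 ^ S m)))%R).
    { apply Rmult_le_compat; auto; apply Cmod_ge_0. }
    assert (H3 : (k * (h * h) * Cmod W <= 2 ^ S m * (h * h) * R0 ^ S (S m))%R).
    { apply Rmult_le_compat.
      - apply Rmult_le_pos; [lra|nra].
      - apply Cmod_ge_0.
      - apply Rmult_le_compat_r; [nra|lra].
      - eapply Rle_trans; [apply HW|]. apply Rle_pow; [lra|lia]. }
    change (2 ^ S (S m))%R with (2 * 2 ^ S m)%R.
    change (R0 ^ S (S m))%R with (R0 * R0 ^ S m)%R in *.
    nra.
Qed.

(** Summing the linearization errors of the powers gives a total error of at most K B |y - w|^2 for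
    [|y - w| <= 1], where [B] is the sum of (2 R0)^k / k! over k >= 1. *)
Lemma is_derive_egf (c : nat -> C) (K : R) (w : C) :
  (forall m, (Cmod (c m) <= K)%R) ->
  @is_derive C_AbsRing C_NormedModule (fun y => CSeries (egf_term c y)) w
    (CSeries (egf_term (fun m => c (S m)) w)).
Proof.
  (* [R0] bounds [w] and every [y] at distance at most 1 from it. *)
  intros Hc. set (R0 := (Cmod w + 1)%R).
  assert (HR : (1 <= R0)%R) by (unfold R0; pose proof (Cmod_ge_0 w); lra).
  assert (HK : (0 <= K)%R) by (eapply Rle_trans; [apply Cmod_ge_0|apply (Hc 0%nat)]).
  assert (Hex : ex_series (fun m => (2 * R0) ^ S m / INR (fact (S m)))%R).
  { apply (ex_series_incr_1 (fun m => (2 * R0) ^ m / INR (fact m))%R). apply ex_series_exp. }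
  destruct Hex as [B HB].
  assert (Hmain : forall y, (Cmod (y - w) <= 1)%R ->
    (Cmod (CSeries (egf_term c y) - CSeries (egf_term c w)
           - (y - w) * CSeries (egf_term (fun m => c (S m)) w))
     <= K * Cmod (y - w) ^ 2 * B)%R).
  { intros y Hy.
    pose proof (CSeries_correct _ (ex_series_egf_term c K y Hc)) as Sy.
    pose proof (CSeries_correct _ (ex_series_egf_term c K w Hc)) as Sw.
    pose proof (CSeries_correct _ (ex_series_egf_term (fun m => c (S m)) K w (fun m => Hc (S m)))) as S1.
    apply (is_series_Cmod_le
      (* The constant terms cancel in the difference; starting at index 1 pairs the term of degree
         [S m] with the term of degree [m] of the derivative. *)
      (fun m => egf_term c y (S m) - egf_term c w (S m) - (y - w) * egf_term (fun m => c (S m)) w m)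
      (fun m => K * Cmod (y - w) ^ 2 * ((2 * R0) ^ S m / INR (fact (S m))))%R).
    - intros m.
      replace (egf_term c y (S m) - egf_term c w (S m) - (y - w) * egf_term (fun m => c (S m)) w m)
        with (c (S m) * ((@pow_n C_Ring y (S m) - @pow_n C_Ring w (S m)
                - RtoC (INR (S m)) * (y - w) * @pow_n C_Ring w m) / RtoC (INR (fact (S m))))).
      + rewrite Cmod_mult, Cmod_div_fact.
        replace (K * Cmod (y - w) ^ 2 * ((2 * R0) ^ S m / INR (fact (S m))))%R
          with (K * ((Cmod (y - w) ^ 2 * (2 * R0) ^ S m) / INR (fact (S m))))%R
          by (unfold Rdiv; ring).
        assert (Hf : (0 < / INR (fact (S m)))%R) by apply Rinv_0_lt_compat, INR_fact_lt_0.
        apply Rmult_le_compat; auto; [apply Cmod_ge_0| |].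
        * apply Rmult_le_pos; [apply Cmod_ge_0|lra].
        * apply Rmult_le_compat_r; [lra|]. apply pow_n_linearization; auto.
          -- unfold R0. lra.
          -- replace y with (w + (y - w)) by ring.
             eapply Rle_trans; [apply Cmod_triangle|]. unfold R0. lra.
      + unfold egf_term.
        assert (Ef : RtoC (INR (fact (S m))) = RtoC (INR (S m)) * RtoC (INR (fact m))).
        { rewrite <- RtoC_mult, <- mult_INR. reflexivity. }
        rewrite Ef.
        assert (RtoC (INR (S m)) <> RtoC 0).
        { intros E. apply RtoC_inj in E. revert E. apply not_0_INR. lia. }
        pose proof (INR_fact_C_neq_0 m). field. auto.
    - apply (is_series_minus (V := C_NormedModule)).
      + replace (CSeries (egf_term c y) - CSeries (egf_term c w))
          with ((CSeries (egf_term c y) - c 0%nat) - (CSeries (egf_term c w) - c 0%nat)) by ring.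
        apply (is_series_minus (V := C_NormedModule)
          (fun m => egf_term c y (S m)) (fun m => egf_term c w (S m))).
        * apply (is_series_incr_1 (V := C_NormedModule) (egf_term c y)).
          replace (@plus C_NormedModule (CSeries (egf_term c y) - c 0%nat) (egf_term c y 0%nat))
            with (CSeries (egf_term c y)); auto.
          change (CSeries (egf_term c y) = CSeries (egf_term c y) - c 0%nat + egf_term c y 0%nat).
          unfold egf_term at 3. simpl. change (@one C_Ring) with (RtoC 1). field.
        * apply (is_series_incr_1 (V := C_NormedModule) (egf_term c w)).
          replace (@plus C_NormedModule (CSeries (egf_term c w) - c 0%nat) (egf_term c w 0%nat))
            with (CSeries (egf_term c w)); auto.
          change (CSeries (egf_term c w) = CSeries (egf_term c w) - c 0%nat + egf_term c w 0%nat).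
          unfold egf_term at 3. simpl. change (@one C_Ring) with (RtoC 1). field.
      + apply (is_series_scal (V := C_NormedModule) (y - w)). exact S1.
    - apply (is_series_scal (V := R_NormedModule) (K * Cmod (y - w) ^ 2)%R). exact HB. }
  split; [apply is_linear_scal_l|].
  intros x Hx. apply (is_filter_lim_locally_unique (V := AbsRing_NormedModule C_AbsRing)) in Hx.
  subst x. intros eps.
  pose proof (cond_pos eps) as Heps.
  (* [Rabs B] makes [L] non-negative without proving the sign of [B], and [L + 1] is a safe
     denominator for the radius. *)
  set (L := (K * Rabs B)%R).
  assert (HL : (0 <= L)%R) by (apply Rmult_le_pos; [auto|apply Rabs_pos]).
  assert (Hd : (0 < Rmin 1 (eps / (L + 1)))%R).
  { apply Rmin_glb_lt; [lra|]. apply Rdiv_lt_0_compat; lra. }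
  exists (mkposreal _ Hd). intros y Hy.
  assert (Hy' : (Cmod (y - w) < Rmin 1 (eps / (L + 1)))%R) by exact Hy.
  pose proof (Rmin_l 1 (eps / (L + 1))). pose proof (Rmin_r 1 (eps / (L + 1))).
  change (Cmod (CSeries (egf_term c y) - CSeries (egf_term c w)
           - (y - w) * CSeries (egf_term (fun m => c (S m)) w)) <= eps * Cmod (y - w))%R.
  eapply Rle_trans; [apply Hmain; lra|].
  pose proof (Cmod_ge_0 (y - w)). set (h := Cmod (y - w)) in *.
  assert (Hh : (h * (L + 1) <= eps)%R).
  { apply Rlt_le. apply (Rmult_lt_reg_r (/ (L + 1))); [apply Rinv_0_lt_compat; lra|].
    rewrite Rmult_assoc, Rinv_r by lra. unfold Rdiv in *. lra. }
  assert (K * h ^ 2 * B <= h * (L * h))%R.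
  { unfold L. replace (h * (K * Rabs B * h))%R with (K * h ^ 2 * Rabs B)%R by ring.
    apply Rmult_le_compat_l; [|apply Rle_abs]. apply Rmult_le_pos; [auto|apply pow2_ge_0]. }
  nra.
Qed.

Lemma CSeries_ext (a b : nat -> C) : (forall m, a m = b m) -> CSeries a = CSeries b.
Proof.
  intros H. unfold CSeries. f_equal; apply Series_ext; intros m; now rewrite H.
Qed.

Lemma is_Cderive_n_egf (c : nat -> C) (K : R) (n : nat) (w : C) :
  (forall m, (Cmod (c m) <= K)%R) ->
  is_Cderive_n (fun y => CSeries (egf_term c y)) n w
    (CSeries (egf_term (fun m => c (n + m)%nat) w)).
Proof.
  intros Hc. revert w. induction n as [|n IH]; intros w.
  - reflexivity.
  - exists (fun y => CSeries (egf_term (fun m => c (n + m)%nat) y)). split.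
    + now apply filter_forall.
    + rewrite (CSeries_ext _ (egf_term (fun m => c (n + S m)%nat) w)).
      * apply (is_derive_egf (fun m => c (n + m)%nat) K). auto.
      * intros m. unfold egf_term. now rewrite Nat.add_succ_r.
Qed.

Lemma CSeries_Cmult (c : C) (a : nat -> C) :
  ex_CSeries a -> CSeries (fun m => c * a m) = c * CSeries a.
Proof.
  intros H. apply is_series_CSeries.
  exact (is_series_scal (V := C_NormedModule) c _ _ (CSeries_correct _ H)).
Qed.

(** * The derivative formula *)

Lemma Cinv_0 : / RtoC 0 = RtoC 0.
Proof. apply C_eq; unfold Re, Im; simpl; unfold Rdiv; ring. Qed.

(* When the beta values vanish, both sides are [0] because [/ 0 = 0]. *)
Lemma Cinv_CBeta_shift (x y : C) (n : nat) :
  (0 < Re x)%R -> (0 < Re y)%R ->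
  pochhammer x n / pochhammer (x + y) n * / CBeta (x + RtoC (INR n)) y = / CBeta x y.
Proof.
  intros Hx Hy.
  assert (Hxy : (0 < Re (x + y))%R) by (change (Re (x + y)) with (Re x + Re y)%R; lra).
  rewrite !pochhammer_rising by auto.
  pose proof (rising_neq_0 x n Hx) as H1. pose proof (rising_neq_0 (x + y) n Hxy) as H2.
  pose proof (CBeta_rising x y n Hx Hy) as E.
  set (r := rising x n) in *. set (s := rising (x + y) n) in *.
  set (B := CBeta x y) in *. set (B' := CBeta (x + RtoC (INR n)) y) in *.
  assert (EB : B = s * B' / r).
  { rewrite <- E. field. auto. }
  destruct (Ceq_dec B' (RtoC 0)) as [H | H].
  - rewrite EB, H. replace (s * RtoC 0 / r) with (RtoC 0) by (field; auto).
    rewrite Cinv_0. ring.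
  - rewrite EB. field. auto.
Qed.

(** [CSeries] and [CInt01] are total and unspecified where convergence fails; the first two
    conjuncts certify that the derivative formula concerns genuine sums and integrals. *)
Theorem theorem4p10 (kappa mu : list C) (alpha beta l2 l3 rho z : C) (n : nat)
  (hkappa : forall k, In k kappa -> ~ nonpos_int k)
  (hmu : forall k, In k mu -> ~ nonpos_int k)
  (halpha : (0 < Re alpha)%R)
  (hl2 : (0 < Re l2)%R) (hl3 : (Re l2 < Re l3)%R)
  (hrho : (0 < Re rho)%R)
  (hdef : MPhi_defined kappa mu alpha beta l2 l3 z rho) :
  @locally C_UniformSpace z
    (fun w => MPhi_defined kappa mu alpha beta l2 l3 w rho)
  /\ MPhi_defined kappa mu alpha beta
       (l2 + RtoC (INR n)) (l3 + RtoC (INR n)) z rho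
  /\ is_Cderive_n (fun w => MPhi kappa mu alpha beta l2 l3 w rho) n z
       (pochhammer l2 n / pochhammer l3 n
        * MPhi kappa mu alpha beta
            (l2 + RtoC (INR n)) (l3 + RtoC (INR n)) z rho).
Proof.
  destruct hdef as [hM _].
  set (y := l3 - l2) in *.
  assert (Hy : (0 < Re y)%R) by (change (Re y) with (Re l3 - Re l2)%R; lra).
  set (M := fun m => MBeta kappa mu alpha beta (l2 + RtoC (INR m)) y rho).
  destruct (MBeta_bounded kappa mu alpha beta l2 y rho hM) as [K HK].
  (* The shift [k] and the divisor [c] stay free, so that one bound serves both the original series
     and the shifted one. *)
  assert (Hb : forall (c : C) k m, (Cmod (M (k + m)%nat * / c) <= K * Cmod (/ c))%R).
  { intros c k m. rewrite Cmod_mult. apply Rmult_le_compat_r; [apply Cmod_ge_0|].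
    apply (HK (k + m)%nat). }
  (* Raising both parameters by [n] leaves their difference unchanged, so the shifted function has
     the same numerators from index [n] on. *)
  assert (E3 : l3 + RtoC (INR n) - (l2 + RtoC (INR n)) = y) by (unfold y; ring).
  assert (Ek : forall m, l2 + RtoC (INR n) + RtoC (INR m) = l2 + RtoC (INR (n + m))).
  { intros m. rewrite plus_INR, RtoC_plus. ring. }
  assert (Eterm : forall w m, MPhi_term kappa mu alpha beta
      (l2 + RtoC (INR n)) (l3 + RtoC (INR n)) w rho m
    = egf_term (fun m => M (n + m)%nat * / CBeta (l2 + RtoC (INR n)) y) w m).
  { intros w m. unfold MPhi_term, egf_term, M. now rewrite E3, Ek. }
  assert (Hex : ex_CSeries (MPhi_term kappa mu alpha beta
      (l2 + RtoC (INR n)) (l3 + RtoC (INR n)) z rho)).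
  { apply (ex_series_ext (V := C_NormedModule) _ _ (fun m => eq_sym (Eterm z m))).
    eapply ex_series_egf_term. intros m. apply Hb. }
  split; [|split].
  - apply filter_forall. intros w. split; [exact hM|].
    apply (ex_series_egf_term (fun m => M m * / CBeta l2 y) (K * Cmod (/ CBeta l2 y))).
    intros m. apply (Hb _ 0%nat).
  - split; [|exact Hex]. intros m. rewrite E3, Ek. apply hM.
  - unfold MPhi at 2. rewrite <- CSeries_Cmult by exact Hex.
    rewrite (CSeries_ext _ (egf_term (fun m => M (n + m)%nat * / CBeta l2 y) z)).
    + apply (is_Cderive_n_egf (fun m => M m * / CBeta l2 y) (K * Cmod (/ CBeta l2 y))).
      intros m. apply (Hb _ 0%nat).
    + intros m. rewrite Eterm. unfold egf_term.
      rewrite <- (Cinv_CBeta_shift l2 y n hl2 Hy).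
      replace (l2 + y) with l3 by (unfold y; ring). ring.
Qed.
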